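(* There exists an algebra morphism $\pi$ from $U_q\mathfrak n_+$ to $\overline{Sh}$ (endowed with the shuffle product $*$), sending each $e_\alpha[n]$ ($1\le\alpha\le r$, $n\in\mathbb Z$) to $(z^{(\alpha)})^n\in\overline{Sh}_{\delta_\alpha}$, where $\delta_\alpha\in\mathbb N^r$ is the vector with coordinates $(\delta_\alpha)_\beta=\delta_{\alpha\beta}$. If $\bar{\mathfrak g}$ is not of type $G_2$, then $\pi$ maps $U_q\mathfrak n_+$ to the subspace $Sh=\bigoplus_{\mathbf n\in\mathbb N^r}Sh_{\mathbf n}$ of $\overline{Sh}$.
   Context: $\bar{\mathfrak g}$ is a simple finite-dimensional complex Lie algebra of rank $r$, with simple roots indexed by $\{1,\dots,r\}$ and Cartan matrix $(a_{\alpha\beta})$; $d_\alpha$ are its symmetrizing factors (so that $(d_\alpha a_{\alpha\beta})$ is a symmetric matrix), $(\alpha,\beta)=d_\alpha a_{\alpha\beta}$, $q$ is a nonzero complex number and $q_\alpha=q^{d_\alpha}$ (so $q_\alpha^{a_{\alpha\beta}}=q^{(\alpha,\beta)}$). **The algebra $U_q\mathfrak n_+$.** It has generators $e_\alpha[n]$ ($\alpha=1,\dots,r$, $n\in\mathbb Z$), with generating series $e_\alpha(z)=\sum_{n\in\mathbb Z}e_\alpha[n]z^{-n}$, and relations $$(q_\alpha^{a_{\alpha\beta}}z-w)\,e_\alpha(z)e_\beta(w)=(z-q_\alpha^{a_{\alpha\beta}}w)\,e_\beta(w)e_\alpha(z)$$ for all $\alpha,\beta$, and for $\alpha\neq\beta$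 the quantum Serre relations $$\sum_{s=0}^{1-a_{\alpha\beta}}(-1)^s\begin{bmatrix}1-a_{\alpha\beta}\\ s\end{bmatrix}_{q_\alpha}\operatorname{Sym}_{z_1\cdots z_{1-a_{\alpha\beta}}}\big(e_\alpha(z_1)\cdots e_\alpha(z_s)e_\beta(w)e_\alpha(z_{s+1})\cdots e_\alpha(z_{1-a_{\alpha\beta}})\big)=0,$$ where $\begin{bmatrix}n\\ p\end{bmatrix}_q=\frac{[n]^!_q}{[p]^!_q[n-p]^!_q}$, $[n]^!_q=[1]_q\cdots[n]_q$, $[n]_q=\frac{q^n-q^{-n}}{q-q^{-1}}$, and $\operatorname{Sym}$ is the sum over all permutations of the variables. **The spaces $\overline{Sh}$ and $Sh$.** For $\mathbf n=(n_1,\dots,n_r)\in\mathbb N^r$ put $I_\alpha=\{1,\dots,n_\alpha\}$. $\overline{Sh}_{\mathbf n}$ is the subspace of $\mathbb C((z^{(1)}_1))\cdots((z^{(r)}_{n_r}))$ (iterated Laurent series, $R((z))=R[[z]][z^{-1}]$, variables ordered $z^{(1)}_1,\dots,z^{(1)}_{n_1},z^{(2)}_1,\dots,z^{(r)}_{n_r}$) formed of the elements (expansions) of the form $$\frac{\prod_\alpha\prod_{i,j\in I_\alpha,\,i<j}(z^{(\alpha)}_i-z^{(\alpha)}_j)}{\prod_{\alpha\le\beta}\prod_{i\in I_\alpha,\,j\in I_\beta,\ i<j\text{ if }\alpha=\beta}(q_\alpha^{a_{\alpha\beta}}z^{(\alpha)}_i-z^{(\beta)}_j)}\,A(z^{(\alpha)}_i),$$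 with $A\in\mathbb C[z^{(\alpha)}_i,z^{(\alpha)-1}_i]$ symmetric in $(z^{(\alpha)}_i)_{i\in I_\alpha}$ for each $\alpha$. $Sh_{\mathbf n}\subset\overline{Sh}_{\mathbf n}$ consists of those elements for which, for any $\alpha\ne\beta$, any $j\in I_\beta$ and any pairwise different $i_1,\dots,i_{1-a_{\alpha\beta}}\in I_\alpha$, $A$ vanishes when $$z^{(\alpha)}_{i_1}=q_\alpha^2z^{(\alpha)}_{i_2}=\cdots=q_\alpha^{-2a_{\alpha\beta}}z^{(\alpha)}_{i_{1-a_{\alpha\beta}}}=q_\alpha^{-a_{\alpha\beta}}z^{(\beta)}_j.$$ $\overline{Sh}=\bigoplus_{\mathbf n\in\mathbb N^r}\overline{Sh}_{\mathbf n}$ and $Sh=\bigoplus_{\mathbf n\in\mathbb N^r}Sh_{\mathbf n}$. **The shuffle product.** Let $f\in\overline{Sh}_{\mathbf n}$, $g\in\overline{Sh}_{\mathbf m}$, $N=\sum_\alpha n_\alpha$, $M=\sum_\alpha m_\alpha$. Rename the variables of $\overline{Sh}_{\mathbf n+\mathbf m}$ as $z_1,\dots,z_{N+M}$, with $z_{n_1+m_1+\cdots+n_{\alpha-1}+m_{\alpha-1}+i}=z^{(\alpha)}_i$ for $i=1,\dots,n_\alpha+m_\alpha$, and let $\alpha(k)$ denote the color of $z_k$, i.e. $\alpha(k)=\alpha$ if $z_k$ is one of the $z^{(\alpha)}_i$. Let $M_{\mathbf n,\mathbf m}$ be the set of bijections $\sigma$ of $\{1,\dots,N+M\}$ such that,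 for each $\alpha$, $\{\sum_{i<\alpha}(n_i+m_i)+1,\dots,\sum_{i\le\alpha}(n_i+m_i)\}$ is the union of $\sigma(\{\sum_{i<\alpha}n_i+1,\dots,\sum_{i\le\alpha}n_i\})$ and $\sigma(\{N+\sum_{i<\alpha}m_i+1,\dots,N+\sum_{i\le\alpha}m_i\})$, and such that $\sigma$ is increasing on each of the sets $\{\sum_{i<\alpha}n_i+1,\dots,\sum_{i\le\alpha}n_i\}$ and $\{N+\sum_{i<\alpha}m_i+1,\dots,N+\sum_{i\le\alpha}m_i\}$. Then $$(f*g)(z_1,\dots,z_{N+M})=\sum_{\sigma\in M_{\mathbf n,\mathbf m}}\varepsilon(\sigma)\prod_{i<j,\ \sigma^{-1}(i)>\sigma^{-1}(j)}\frac{q^{(\alpha(i),\alpha(j))}z_i-z_j}{z_i-q^{(\alpha(i),\alpha(j))}z_j}\ f(z_{\sigma(1)},\dots,z_{\sigma(N)})\,g(z_{\sigma(N+1)},\dots,z_{\sigma(N+M)}),$$ where $\varepsilon(\sigma)$ is the signature of $\sigma$.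
   Formalization: As printed the quadratic relation fails by a sign; the pair denominators are corrected for i<j to q^{(α(i),α(j))}z_j − z_i, both in the shuffle product (printed z_i − q^{(..)}z_j) and in the definition of Sh-bar and Sh (printed q^{(..)}z_i − z_j). *)

(* Defs.v *)
From HB Require Import structures.
From mathcomp Require Import all_boot all_order all_algebra.
From mathcomp Require Import perm ring_quotient fraction boolp reals complex mpoly.
From mathcomp Require Import zify ring.
(* The notations of monalg clash with those of mpoly. *)
From mathcomp Require Import -(notations) monalg.

Set Implicit Arguments.
Unset Strict Implicit.
Unset Printing Implicit Defensive.

Import Order.TTheory GRing.Theory Num.Theory.
Local Open Scope ring_scope.
Local Open Scope quotient_scope.

(* By the Killing-Cartan classification, the Cartan matrices of the simple
   finite-dimensional complex Lie algebras of rank r are the indecomposable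
   Cartan matrices of finite type; [d] is a family of symmetrizing factors. *)
Record simple_cartan (r : nat) (A : 'M[int]_r) (d : 'I_r -> nat) : Prop := {
  cartan_rank_gt0 : (0 < r)%N;
  cartan_diag : forall i, A i i = 2;
  cartan_offdiag : forall i j, i != j -> A i j <= 0;
  cartan_zero : forall i j, A i j = 0 -> A j i = 0;
  cartan_indec : forall S : {set 'I_r}, S != set0 -> S != setT ->
    exists i j, [/\ i \in S, j \notin S & A i j != 0];
  cartan_sym_gt0 : forall i, (0 < d i)%N;
  cartan_sym : forall i j, (d i)%:Z * A i j = (d j)%:Z * A j i;
  cartan_posdef : forall x : 'rV[rat]_r, x != 0 ->
    0 < \sum_i \sum_j ((d i)%:Z * A i j)%:~R * x 0 i * x 0 j
}.

Definition type_G2 (r : nat) (A : 'M[int]_r) : Prop :=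
  exists i j : 'I_r,
    [/\ i != j, [set: 'I_r] = [set i; j], A i j = -1 & A j i = -3].

Section QBinomial.
Variable F : fieldType.

Definition qint (v : F) (n : nat) : F :=
  \sum_(k < n) v ^ (n%:Z - 1 - k%:Z *+ 2).

Definition qfact (v : F) (n : nat) : F := \prod_(1 <= k < n.+1) qint v k.

(* The Gaussian binomial is a Laurent polynomial in v; it is defined through
   the Pascal rule, so that it has the right value when some [k]_v vanish. *)
Fixpoint qbinom (v : F) (n p : nat) {struct n} : F :=
  match n, p with
  | _, 0 => 1
  | 0, _.+1 => 0
  | n'.+1, p'.+1 =>
      v ^ p%:Z * qbinom v n' p + v ^ (p%:Z - n%:Z) * qbinom v n' p'
  end.

Lemma qintE (v : F) n : v != 0 ->
  (v - v^-1) * qint v n = v ^ n%:Z - v ^ (- n%:Z).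
Proof.
move=> v0; rewrite /qint mulr_sumr.
pose g k := - v ^ (n%:Z - k%:Z *+ 2).
rewrite (eq_bigr (fun k : 'I_n => g k.+1 - g k)) => [|k _]; last first.
  rewrite /g mulrBl -{1}[v]expr1z -exprN1 -!expfzDr // opprK addrC.
  by congr (- v ^ _ + v ^ _); lia.
rewrite -(big_mkord xpredT (fun k => g k.+1 - g k)) telescope_sumr // /g.
by rewrite opprK addrC; congr (v ^ _ - v ^ _); lia.
Qed.

Lemma qbinom0 (v : F) n : qbinom v n 0 = 1. Proof. by case: n. Qed.

Lemma qbinom_small (v : F) n p : (n < p)%N -> qbinom v n p = 0.
Proof.
elim: n p => [|n IH] [|p] //= np; rewrite !IH ?mulr0 ?addr0 //.
by apply: ltnW.
Qed.

Lemma qintD (v : F) m n : v != 0 ->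
  qint v (m + n) = v ^ n%:Z * qint v m + v ^ (- m%:Z) * qint v n.
Proof.
move=> v0; rewrite /qint big_split_ord /= !mulr_sumr.
by congr (_ + _); apply: eq_bigr => k _; rewrite -expfzDr //;
  congr (v ^ _); lia.
Qed.

Lemma qfactS (v : F) n : qfact v n.+1 = qfact v n * qint v n.+1.
Proof. by rewrite /qfact big_nat_recr. Qed.

Lemma qbinomE (v : F) n p : v != 0 -> (p <= n)%N ->
  qbinom v n p * (qfact v p * qfact v (n - p)) = qfact v n.
Proof.
move=> v0; elim: n p => [|n IH] [|p] // pn.
- by rewrite /= /qfact !big_geq // !mulr1.
- by rewrite qbinom0 subn0 {1}/qfact big_geq // !mul1r.
rewrite subSS [qbinom _ _ _]/=.
have {}pn : (p <= n)%N by [].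
rewrite (qfactS v n).
have -> : qint v n.+1 = v ^ p.+1%:Z * qint v (n - p)
                      + v ^ (p.+1%:Z - n.+1%:Z) * qint v p.+1.
  have -> : (n.+1 = (n - p) + p.+1)%N by lia.
  by rewrite qintD //; congr (_ + v ^ _ * _); lia.
rewrite mulrDl mulrDr; congr (_ + _).
  case: (ltnP p n) => [ltpn|lenp].
    have /= := IH _ ltpn; have -> : (n - p = (n - p.+1).+1)%N by lia.
    rewrite [qfact v (n - p.+1).+1]qfactS => <-; ring.
  rewrite qbinom_small // mulr0 mul0r.
  have -> : (n - p = 0)%N by lia.
  by rewrite /qint big_ord0 !mulr0.
rewrite -(IH _ pn) qfactS.
ring.
Qed.

End QBinomial.

Lemma malg_scalerAr (K : monomType) (F : comNzRingType) c (x y : malg K F) :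
  c *: (x * y) = x * (c *: y).
Proof.
rewrite !malgM_def (fgmulrw (finmap.fsubset_refl _) (msuppZ_le c y)) fgmulr.
rewrite scaler_sumr; apply: eq_bigr => k _; rewrite scaler_sumr.
apply: eq_bigr => l _; apply/malgP => m.
by rewrite mcoeffZ !mcoeffU mcoeffZ mulrnAr mulrCA.
Qed.

Section Augmentation.
Variables (K : monomType) (F : comNzRingType).
Implicit Types x y : malg K F.

Lemma augB x y :
  mcoeff mone x = 0 -> mcoeff mone y = 0 -> mcoeff mone (x - y) = 0.
Proof. by move=> hx hy; rewrite mcoeffB hx hy subr0. Qed.

Lemma augZ c x : mcoeff mone x = 0 -> mcoeff mone (c *: x) = 0.
Proof. by move=> hx; rewrite mcoeffZ hx mulr0. Qed.

Lemma augMl x y : mcoeff mone x = 0 -> mcoeff mone (x * y) = 0.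
Proof. by move=> hx; rewrite rmorphM /= hx mul0r. Qed.

Lemma augMr x y : mcoeff mone y = 0 -> mcoeff mone (x * y) = 0.
Proof. by move=> hy; rewrite rmorphM /= hy mulr0. Qed.

Lemma aug_sum (I : finType) (f : I -> malg K F) :
  (forall i, mcoeff mone (f i) = 0) -> mcoeff mone (\sum_i f i) = 0.
Proof. by move=> hf; rewrite raddf_sum big1 // => i _; apply: hf. Qed.

End Augmentation.

Section CurrentAlgebra.
Variables (F : fieldType) (r : nat) (A : 'M[int]_r) (d : 'I_r -> nat) (q : F).

Definition form (a b : 'I_r) : int := (d a)%:Z * A a b.

Definition serre_len (a b : 'I_r) : nat := `|1 - A a b|%N.

Local Notation free_alg := (malg (fmonom ('I_r * int)%type) F).

Definition free_gen (a : 'I_r) (k : int) : free_alg := mkmalgU (fmu (a, k)) 1.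

(* Coefficient of z^-k w^-l in the relation between e_a(z) and e_b(w). *)
Definition quad_rel (a b : 'I_r) (k l : int) : free_alg :=
  (q ^ form a b *: (free_gen a (k + 1) * free_gen b l)
     - free_gen a k * free_gen b (l + 1))
  - (free_gen b l * free_gen a (k + 1)
     - q ^ form a b *: (free_gen b (l + 1) * free_gen a k)).

(* Coefficient of z_1^-k_1 ... z_m^-k_m w^-l in the quantum Serre relation. *)
Definition serre_rel (a b : 'I_r) (k : 'I_(serre_len a b) -> int) (l : int) :
    free_alg :=
  \sum_(s < (serre_len a b).+1)
    ((-1) ^+ s * qbinom (q ^+ d a) (serre_len a b) s) *:
    \sum_(t : 'S_(serre_len a b))
      (\prod_(i < serre_len a b | (i < s)%N) free_gen a (k (t i)))
      * free_gen b l
      * (\prod_(i < serre_len a b | (s <= i)%N) free_gen a (k (t i))).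

Inductive rel_ideal : free_alg -> Prop :=
| rel_quad a b k l : rel_ideal (quad_rel a b k l)
| rel_serre a b k l : a != b -> rel_ideal (@serre_rel a b k l)
| rel_zero : rel_ideal 0
| rel_sub x y : rel_ideal x -> rel_ideal y -> rel_ideal (x - y)
| rel_mul x u y : rel_ideal u -> rel_ideal (x * u * y).

Definition rel_idealb : {pred free_alg} := fun x => `[< rel_ideal x >].

Lemma rel_idealP x : reflect (rel_ideal x) (x \in rel_idealb).
Proof. exact: asboolP. Qed.

Lemma rel_idealb_zmod : zmod_closed rel_idealb.
Proof.
split; first exact/rel_idealP/rel_zero.
by move=> x y /rel_idealP hx /rel_idealP hy; apply/rel_idealP/rel_sub.
Qed.

HB.instance Definition _ :=
  GRing.isZmodClosed.Build free_alg rel_idealb rel_idealb_zmod.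

Lemma rel_idealMl x u : u \in rel_idealb -> x * u \in rel_idealb.
Proof.
by move=> /rel_idealP hu; apply/rel_idealP; rewrite -[x * u]mulr1; apply: rel_mul.
Qed.

Lemma rel_idealMr x u : u \in rel_idealb -> u * x \in rel_idealb.
Proof.
by move=> /rel_idealP hu; apply/rel_idealP; rewrite -[u]mul1r; apply: rel_mul.
Qed.

Lemma rel_idealZ c u : u \in rel_idealb -> c *: u \in rel_idealb.
Proof. by move=> hu; rewrite -[u]mul1r scalerAl rel_idealMl. Qed.

(* The relators have no constant term, so the quotient is nonzero. *)
Lemma rel_ideal_augm (x : free_alg) : rel_ideal x -> mcoeff mone x = 0.
Proof.
have g0 a k : mcoeff mone (free_gen a k) = 0.
  by rewrite mcoeffU -fdeg_eq0 fdegE fmuE.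
elim=> {x} [a b k l|a b k l _||x y _ hx _ hy|x u y _ hu].
- apply: augB; apply: augB; first apply: augZ.
  + exact: augMl.
  + exact: augMl.
  + exact: augMl.
  + by apply: augZ; apply: augMl.
- apply: aug_sum => s; apply: augZ; apply: aug_sum => t.
  by apply: augMl; apply: augMr.
- exact: mcoeff0.
- exact: augB.
- by apply: augMl; apply: augMr.
Qed.

Definition Uqn := Quotient.quot rel_idealb.
HB.instance Definition _ := GRing.Zmodule.on Uqn.
HB.instance Definition _ := EqQuotient.on Uqn.

Definition uone : Uqn := lift_cst Uqn 1.
Definition umul := lift_op2 Uqn ( *%R : free_alg -> free_alg -> free_alg).
Definition uscale (c : F) := lift_op1 Uqn ( *:%R c : free_alg -> free_alg).

Canonical pi_uone_morph := PiConst uone.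

Lemma pi_umul : {morph \pi_Uqn : x y / x * y >-> umul x y}.
Proof.
move=> x y; unlock umul; apply/eqP; rewrite -Quotient.idealrBE.
set x' := repr _; set y' := repr _.
have hx : x - x' \in rel_idealb by rewrite Quotient.idealrBE reprK.
have hy : y - y' \in rel_idealb by rewrite Quotient.idealrBE reprK.
have -> : x * y - x' * y' = (x - x') * y + x' * (y - y').
  by rewrite mulrBl mulrBr addrA addrNK.
by apply: rpredD; [apply: rel_idealMr | apply: rel_idealMl].
Qed.
Canonical pi_umul_morph := PiMorph2 pi_umul.

Lemma pi_uscale c : {morph \pi_Uqn : x / c *: x >-> uscale c x}.
Proof.
move=> x; unlock uscale; apply/eqP; rewrite -Quotient.idealrBE -scalerBr.
by rewrite rel_idealZ // Quotient.idealrBE reprK.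
Qed.
Canonical pi_uscale_morph c := PiMorph1 (pi_uscale c).

Lemma umulA : associative umul.
Proof. by move=> x y z; rewrite -[x]reprK -[y]reprK -[z]reprK !piE mulrA. Qed.
Lemma umul1r : left_id uone umul.
Proof. by move=> x; rewrite -[x]reprK !piE mul1r. Qed.
Lemma umulr1 : right_id uone umul.
Proof. by move=> x; rewrite -[x]reprK !piE mulr1. Qed.
Lemma umulDl : left_distributive umul +%R.
Proof. by move=> x y z; rewrite -[x]reprK -[y]reprK -[z]reprK !piE mulrDl. Qed.
Lemma umulDr : right_distributive umul +%R.
Proof. by move=> x y z; rewrite -[x]reprK -[y]reprK -[z]reprK !piE mulrDr. Qed.
Lemma uone_neq0 : uone != 0 :> Uqn.
Proof.
have <- : \pi_Uqn 0 = 0 by rewrite piE.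
have <- : \pi_Uqn 1 = uone by rewrite piE.
rewrite -Quotient.idealrBE subr0; apply/rel_idealP => /rel_ideal_augm.
by rewrite mcoeff1 eqxx; apply/eqP/oner_neq0.
Qed.

HB.instance Definition _ := GRing.Zmodule_isNzRing.Build Uqn
  umulA umul1r umulr1 umulDl umulDr uone_neq0.

Lemma uscaleA c c' (x : Uqn) : uscale c (uscale c' x) = uscale (c * c') x.
Proof. by rewrite -[x]reprK !piE scalerA. Qed.
Lemma uscale1 : left_id 1 uscale.
Proof. by move=> x; rewrite -[x]reprK !piE scale1r. Qed.
Lemma uscaleDr : right_distributive uscale +%R.
Proof. by move=> c x y; rewrite -[x]reprK -[y]reprK !piE scalerDr. Qed.
Lemma uscaleDl (x : Uqn) : {morph uscale^~ x : c c' / c + c'}.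
Proof. by move=> c c'; rewrite -[x]reprK !piE scalerDl. Qed.

HB.instance Definition _ := GRing.Zmodule_isLmodule.Build F Uqn
  uscaleA uscale1 uscaleDr uscaleDl.

Lemma uscaleAl c (x y : Uqn) : c *: (x * y) = (c *: x) * y.
Proof.
rewrite -[x]reprK -[y]reprK /GRing.scale /GRing.mul /= !piE.
by rewrite scalerAl.
Qed.
HB.instance Definition _ := GRing.Lmodule_isLalgebra.Build F Uqn uscaleAl.

Lemma uscaleAr c (x y : Uqn) : c *: (x * y) = x * (c *: y).
Proof.
rewrite -[x]reprK -[y]reprK /GRing.scale /GRing.mul /= !piE.
by rewrite malg_scalerAr.
Qed.
HB.instance Definition _ := GRing.Lalgebra_isAlgebra.Build F Uqn uscaleAr.

Definition ugen (a : 'I_r) (k : int) : Uqn := \pi_Uqn (free_gen a k).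

End CurrentAlgebra.

Section Shuffle.
Variables (F : fieldType) (r : nat) (A : 'M[int]_r) (d : 'I_r -> nat) (q : F).

Local Notation degree := {ffun 'I_r -> nat}.

(* The index set of the variables of degree n: [tagnat] enumerates the pairs
   (color a, i in 'I_(n a)) in lexicographic order. *)
Local Notation idx n := 'I_(\sum_a n a)%N.

(* Rational functions in the variables z^(a)_i.  The expansion map into the
   iterated Laurent series is an injective field morphism, so the spaces of
   expansions are identified with spaces of rational functions. *)
Local Notation ratf n := {fraction {mpoly F[\sum_a n a]}}.

Definition color (n : degree) (i : idx n) : 'I_r := tagnat.sig1 i.

Definition cst (n : degree) (c : F) : ratf n := tofrac c%:MP.
Definition z (n : degree) (i : idx n) : ratf n := tofrac 'X_i.

(* Renaming of variables z_k |-> z_(h k), for an injective h. *)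
Definition renamep (n p : degree) (h : idx n -> idx p)
    (P : {mpoly F[\sum_a n a]}) : {mpoly F[\sum_a p a]} :=
  P \mPo [tuple 'X_(h i) | i < \sum_a n a].

Definition rename (n p : degree) (h : idx n -> idx p) (f : ratf n) : ratf p :=
  tofrac (renamep h (\n_(repr f))) / tofrac (renamep h (\d_(repr f))).

Lemma renamep_inj (n p : degree) (h : idx n -> idx p) :
  injective h -> injective (renamep h).
Proof.
move=> hinj.
pose t := [tuple if [pick i | h i == j] is Some i then 'X_i else 0
          | j < \sum_a p a] : (\sum_a p a).-tuple {mpoly F[\sum_a n a]}.
apply: (can_inj (g := comp_mpoly t)) => P.
rewrite /renamep -[RHS]comp_mpoly_id !(comp_mpolyEX P) linear_sum.
apply: eq_bigr => m _.
rewrite linearZ /=; congr (_ *: _); rewrite !(comp_mpolyX m) rmorph_prod.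
apply: eq_bigr => i _.
rewrite rmorphXn /= !tnth_mktuple; congr (_ ^+ _).
rewrite comp_mpolyXU -tnth_nth tnth_mktuple.
by case: pickP => [i' /eqP /hinj -> //|/(_ i)]; rewrite eqxx.
Qed.

Lemma frac_numden (R : idomainType) (f : {fraction R}) :
  f = tofrac \n_(repr f) / tofrac \d_(repr f).
Proof.
have dnz : tofrac \d_(repr f) != 0 by rewrite tofrac_eq0 denom_ratioP.
apply: (mulIf dnz); rewrite divfK // -{1}[f]reprK; unlock tofrac.
rewrite -[LHS]FracField.pi_mul; apply/eqmodP.
rewrite /= FracField.equivfE /= /FracField.mulf /=.
by rewrite !numden_Ratio ?(oner_neq0, mulf_neq0, denom_ratioP) // !mulr1 mulrC.
Qed.

(* [rename] does not depend on the chosen representatives. *)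
Lemma renameE (n p : degree) (h : idx n -> idx p) (P Q : {mpoly F[_]}) :
  injective h -> Q != 0 ->
  rename h (tofrac P / tofrac Q)
    = tofrac (renamep h P) / tofrac (renamep h Q).
Proof.
move=> hinj Q0; rewrite /rename; set f := tofrac P / tofrac Q.
have renamep_neq0 (B : {mpoly F[_]}) : B != 0 -> renamep h B != 0.
  by rewrite -(inj_eq (renamep_inj hinj)) {2}/renamep comp_mpoly0.
have dnz : \d_(repr f) != 0 by apply: denom_ratioP.
have := frac_numden f; rewrite {1}/f => /eqP.
rewrite eqr_div ?tofrac_eq0 // -!tofracM tofrac_eq => /eqP eqPQ.
apply/eqP; rewrite eqr_div ?tofrac_eq0 ?renamep_neq0 // -!tofracM tofrac_eq.
by rewrite /renamep -!rmorphM /= eqPQ.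
Qed.

(* q^(color i, color j) z_i - z_j *)
Definition qdiff (n : degree) (i j : idx n) : ratf n :=
  cst n (q ^ form A d (color i) (color j)) * z i - z j.

Section Components.
Variable n : degree.

(* A in C[z^(a)_i, (z^(a)_i)^-1] *)
Definition laurent_frac (P : {mpoly F[\sum_a n a]}) (k : nat) : ratf n :=
  tofrac P / (\prod_i z i) ^+ k.

Definition is_laurent (f : ratf n) : Prop :=
  exists P k, f = laurent_frac P k.

Definition color_symmetric (f : ratf n) : Prop :=
  forall s : 'S_(\sum_a n a), (forall i, color (s i) = color i) ->
    rename s f = f.

(* The Laurent polynomial f vanishes at v, whose coordinates are nonzero. *)
Definition vanishes_at (f : ratf n) (v : idx n -> F) : Prop :=
  exists P k, f = laurent_frac P k /\ P.@[v] / (\prod_i v i) ^+ k = 0.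

(* z_(t 0) = q_a^2 z_(t 1) = ... = q_a^(-2 a_ab) z_(t (- a_ab))
           = q_a^(- a_ab) z_j *)
Definition on_wheel (a b : 'I_r) (t : 'I_(serre_len A a b) -> idx n)
    (j : idx n) (v : idx n -> F) : Prop :=
  forall l : 'I_(serre_len A a b),
    (q ^+ d a) ^+ (2 * l) * v (t l) = (q ^+ d a) ^ (- A a b) * v j.

Definition wheel_condition (f : ratf n) : Prop :=
  forall (a b : 'I_r) (t : 'I_(serre_len A a b) -> idx n) (j : idx n)
      (v : idx n -> F),
    a != b -> color j = b -> injective t -> (forall l, color (t l) = a) ->
    (forall i, v i != 0) -> on_wheel t j v -> vanishes_at f v.

(* The pairs ((a, i), (b, j)) with a <= b, and i < j if a = b, are exactly the
   pairs of indices i < j.  See [shuffle_hom] for the denominators. *)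
Definition prefactor : ratf n :=
  (\prod_(i : idx n) \prod_(j : idx n | (i < j)%N && (color i == color j))
     (z i - z j))
  / \prod_(i : idx n) \prod_(j : idx n | (i < j)%N) qdiff j i.

Definition Shbar_comp (f : ratf n) : Prop :=
  exists B, [/\ is_laurent B, color_symmetric B & f = prefactor * B].

Definition Sh_comp (f : ratf n) : Prop :=
  exists B, [/\ is_laurent B, color_symmetric B, wheel_condition B
              & f = prefactor * B].

End Components.

Section HomogeneousProduct.
Variables n m p : degree.
Hypothesis npm : forall a, (n a + m a = p a)%N.

Lemma size_split : (\sum_a n a + \sum_a m a = \sum_a p a)%N.
Proof. by rewrite -big_split; apply: eq_bigr. Qed.

(* The positions 1, ..., N and N + 1, ..., N + M. *)
Definition lpos (i : idx n) : idx p :=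
  cast_ord size_split (lshift (\sum_a m a)%N i).
Definition rpos (j : idx m) : idx p :=
  cast_ord size_split (rshift (\sum_a n a)%N j).

(* Color-preserving and increasing on each block of each factor. *)
Definition is_shuffle (s : 'S_(\sum_a p a)) : bool :=
  [&& [forall a, [set x : idx p | color x == a] ==
         (s @: (lpos @: [set i : idx n | color i == a]))
         :|: (s @: (rpos @: [set j : idx m | color j == a]))],
      [forall i : idx n, forall i' : idx n,
         (color i == color i') && (i < i')%N
         ==> (s (lpos i) < s (lpos i'))%N]
    & [forall j : idx m, forall j' : idx m,
         (color j == color j') && (j < j')%N
         ==> (s (rpos j) < s (rpos j'))%N]].

(* Orientation of the denominators.  Both here and in [prefactor], a pair i < j
   has denominator q^(c_i, c_j) z_j - z_i.  The source prints z_i - q^(..) z_j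
   here, which combined with the signature is off by one sign per inversion,
   and q^(..) z_i - z_j in the prefactor.  As printed, already in rank 1,
     1 * 1 = (1 - q^2) (z_1 + z_2) / (z_1 - q^2 z_2)
   is not in the printed space, and the images of the e_a[n] satisfy the
   opposite sign in the quadratic relation.  The relation between e_a(z) and
   e_b(w) together with e_a[n] |-> (z^(a))^n forces the orientation below. *)
Definition shuffle_hom (f : ratf n) (g : ratf m) : ratf p :=
  \sum_(s : 'S_(\sum_a p a) | is_shuffle s)
    (-1) ^+ odd_perm s
    * (\prod_(i : idx p) \prod_(j : idx p |
          (i < j)%N && ((s^-1)%g j < (s^-1)%g i)%N)
         (qdiff i j / qdiff j i))
    * rename (fun i => s (lpos i)) f * rename (fun j => s (rpos j)) g.

End HomogeneousProduct.

Definition ratfam := forall n : degree, ratf n.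

Definition finsupp (f : ratfam) : Prop :=
  exists s : seq degree, forall n, n \notin s -> f n = 0.

Definition in_Shbar (f : ratfam) : Prop :=
  finsupp f /\ forall n, Shbar_comp (f n).

Definition in_Sh (f : ratfam) : Prop :=
  finsupp f /\ forall n, Sh_comp (f n).

Definition shuffle_one : ratfam := fun n => (n == [ffun => 0%N])%:R.

(* The summation runs over the decompositions p = n + m. *)
Definition ldeg (p : degree) (n : {dffun forall a : 'I_r, 'I_(p a).+1}) : degree :=
  [ffun a => n a : nat].
Definition rdeg (p : degree) (n : {dffun forall a : 'I_r, 'I_(p a).+1}) : degree :=
  [ffun a => (p a - n a)%N].

Lemma deg_split (p : degree) (n : {dffun forall a : 'I_r, 'I_(p a).+1}) a :
  (ldeg n a + rdeg n a = p a)%N.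
Proof. by rewrite !ffunE subnKC // -ltnS. Qed.

Definition shuffle (f g : ratfam) : ratfam := fun p =>
  \sum_(n : {dffun forall a : 'I_r, 'I_(p a).+1})
     shuffle_hom (deg_split n) (f (ldeg n)) (g (rdeg n)).

Definition delta (a : 'I_r) : degree := [ffun b => (b == a)%N : nat].

(* In degree [delta a] there is only one variable, so that the product below
   is (z^(a))^k. *)
Definition zpow (a : 'I_r) (k : int) : ratfam := fun n =>
  if n == delta a then \prod_(i : idx n) z i ^ k else 0.

Definition is_alg_morphism (U : algType F) (pi : U -> ratfam) : Prop :=
  [/\ forall c x y n, pi (c *: x + y) n = cst n c * pi x n + pi y n,
      forall n, pi 1 n = shuffle_one n
    & forall x y n, pi (x * y) n = shuffle (pi x) (pi y) n].

End Shuffle.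

(* Main.v *)
(* The word e_(a_1)[k_1] ... e_(a_N)[k_N] is sent to the sum over all
   enumerations x_1, ..., x_N of the variables, with alpha(x_k) = a_k, of
     prod_(k < l) +-(q^(alpha(x_k), alpha(x_l)) z_(x_l) - z_(x_k)) * prod_k z_(x_k)^(k_k),
   where the sign is the signature of the enumeration, divided by the product of
   the q-differences over all pairs of variables.  Cutting the enumerations at a
   fixed position amounts to choosing a set of variables, i.e. a shuffle, whence
   multiplicativity.  The quadratic relations follow by exchanging two adjacent
   variables.  For the Serre relations, singling out the variable of color beta
   turns each alpha-letter into a linear combination of two letters that
   q-commute, and the alternating sum becomes a q-binomial identity in the
   quantum plane.  The numerator is antisymmetric in the variables of each color,
   hence divisible by the Vandermonde.  On a wheel every enumeration has a
   vanishing factor, since otherwise the wheel would be enumerated in a cyclic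
   order; the quotient by the Vandermonde is then shown to vanish by
   treating q as an indeterminate, which keeps the coordinates of the wheel
   distinct, and specializing. *)

Require Import Defs.
From HB Require Import structures.
From mathcomp Require Import all_boot all_order all_algebra.
From mathcomp Require Import perm ring_quotient fraction boolp reals complex mpoly.
From mathcomp Require Import zify ring.
From mathcomp Require Import -(notations) monalg.

Set Implicit Arguments.
Unset Strict Implicit.
Unset Printing Implicit Defensive.

Import Order.TTheory GRing.Theory Num.Theory.
Local Open Scope ring_scope.
Local Open Scope quotient_scope.

(** * Sums over enumerations of a finite set *)

Section WordSum.
Variables (K : comNzRingType) (T : finType) (G : T -> T -> K).
Implicit Types (ph : T -> K) (u v : seq (T -> K)) (F : {set T} -> K) (X Y S : {set T}).

(** The denominator of an image is the same for all enumerations of the variables, so the identities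
    are proved for numerators alone. Numerators make sense over any commutative ring, which is what
    permits replacing [q] by an indeterminate. Relations between words thus become relations between
    operators, valid on whatever function they are applied to. The delicate point is that [q] is
    only assumed nonzero. At a root of unity a wheel may have equal coordinates of the same color;
    the Vandermonde vanishes there, and the vanishing of the numerator says nothing about the
    quotient. Some [[k]_v] may vanish as well, so [qbinom] is handled through its Pascal rules and
    never as a quotient. *)

Definition letter_op ph F X : K :=
  \sum_(x in X) ph x * (\prod_(y in X :\ x) G x y) * F (X :\ x).

(* The sum over all enumerations [x_1, ..., x_n] of [X] of
   [prod_(i < j) G x_i x_j * prod_i ph_i x_i]. *)
Definition word_sum u : {set T} -> K :=
  foldr letter_op (fun X => (X == set0)%:R) u.

Lemma letter_op_ext ph ph' F F' X :
  (forall x, x \in X -> ph x = ph' x) ->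
  (forall x, x \in X -> F (X :\ x) = F' (X :\ x)) ->
  letter_op ph F X = letter_op ph' F' X.
Proof. by move=> e1 e2; apply: eq_bigr => x xX; rewrite e1 // e2. Qed.

(** Apart from the two letters and [G p.1 p.2], the summand is symmetric in the two variables, so
    exchanging adjacent letters concerns a single kernel factor. *)
Lemma letter_op2 ph psi F X :
  letter_op ph (letter_op psi F) X
   = \sum_(p | [&& p.1 \in X, p.2 \in X & p.1 != p.2]) ph p.1 * psi p.2 * G p.1 p.2
     * (\prod_(w in X :\ p.1 :\ p.2) (G p.1 w * G p.2 w)) * F (X :\ p.1 :\ p.2).
Proof.
transitivity (\sum_(x in X) \sum_(y in X :\ x)  ph x * psi y * G x y
     * (\prod_(w in X :\ x :\ y) (G x w * G y w)) * F (X :\ x :\ y)).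
  apply: eq_bigr => x xX; rewrite mulr_sumr; apply: eq_bigr => y yX.
  by rewrite (big_setD1 y) //= big_split /=; ring.
rewrite pair_big_dep; apply: eq_bigl => -[x y] /=.
by rewrite !inE eq_sym; case: (x \in X); rewrite //= andbC.
Qed.

Lemma letter_opZl k ph F X :
  letter_op (fun x => k * ph x) F X = k * letter_op ph F X.
Proof. by rewrite mulr_sumr; apply: eq_bigr => x _; rewrite !mulrA. Qed.

Lemma letter_opZr k ph F X :
  letter_op ph (fun Y => k * F Y) X = k * letter_op ph F X.
Proof. by rewrite mulr_sumr; apply: eq_bigr => x _; rewrite mulrCA. Qed.

Lemma eq_word_sum u v X :
  size u = size v ->
  (forall i x, (i < size u)%N -> x \in X ->
     nth (fun=> 0) u i x = nth (fun=> 0) v i x) ->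
  word_sum u X = word_sum v X.
Proof.
elim: u v X => [|ph u IH] [|ph' v] X //= [sz] e.
apply: letter_op_ext => [x xX|x xX]; first exact: (e 0%N).
apply: IH => // i y iu; rewrite !inE => /andP[_ yX]; exact: (e i.+1).
Qed.

Lemma sum_subset_mem (M : nmodType) X (x : T) (H : {set T} -> M) : x \in X ->
  \sum_(S : {set T} | (S \subset X) && (x \in S)) H S
    = \sum_(S : {set T} | S \subset X :\ x) H (x |: S).
Proof.
move=> xX; rewrite (reindex_onto (fun S => x |: S) (fun S => S :\ x)) /=; last first.
  by move=> S /andP[_ xS]; rewrite setD1K.
apply: eq_bigl => S; rewrite setU11 andbT subsetD1 subUset sub1set xX /=.
case: (boolP (S \subset X)) => //= _.
apply/eqP/idP => [<-|xS]; first by rewrite !inE eqxx.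
by rewrite setU1K.
Qed.

(** The double product collects the kernel factors across the cut; it is this cross term that the
    shuffle product has to reproduce. *)
Lemma word_sum_cat u v X :
  word_sum (u ++ v) X = \sum_(S : {set T} | S \subset X)
    (\prod_(x in S) \prod_(y in X :\: S) G x y) * word_sum u S
      * word_sum v (X :\: S).
Proof.
elim: u X => [|ph u IH] X /=.
  rewrite (bigD1 set0) ?sub0set //= big_set0 big1 => [|S /andP[_ S0]].
    by rewrite eqxx !mul1r addr0 setD0.
  by rewrite (negbTE S0) mulr0 mul0r.
transitivity (\sum_(x in X) \sum_(S : {set T} | (S \subset X) && (x \in S))
    (\prod_(x in S) \prod_(y in X :\: S) G x y)
     * (ph x * (\prod_(y in S :\ x) G x y) * word_sum u (S :\ x))
     * word_sum v (X :\: S)).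
  apply: eq_bigr => x xX; rewrite sum_subset_mem // IH mulr_sumr.
  apply: eq_bigr => S; rewrite subsetD1 => /andP[SX xS].
  rewrite setU1K // (big_setU1 _ xS) /=.
  have -> : X :\: (x |: S) = X :\ x :\: S by rewrite setDDl.
  have -> : \prod_(y in X :\ x) G x y
      = \prod_(y in S) G x y * \prod_(y in X :\ x :\: S) G x y.
    rewrite (big_setID S) /=; congr (_ * _); apply: eq_bigl => y.
    rewrite !inE; case: (boolP (y \in S)) => yS; rewrite ?andbF // (subsetP SX) //.
    by rewrite andbT andbT; apply: contraNneq xS => <-.
  ring.
rewrite (exchange_big_dep (fun S : {set T} => S \subset X)) /=; last by move=> x S _ /andP[].
apply: eq_bigr => S SX; rewrite mulr_sumr mulr_suml.
apply: eq_bigl => x; rewrite SX /=.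
by apply/andP/idP => [[]|xS] //; rewrite (subsetP SX).
Qed.

(** Each term uses every variable of [Y] exactly once, so a factor common to all letters does not
    depend on the enumeration. *)
Lemma word_sum_mul u h Y :
  word_sum [seq (fun x => ph x * h x) | ph <- u] Y
    = (\prod_(y in Y) h y) * word_sum u Y.
Proof.
elim: u Y => [|ph u IH] Y /=.
  by case: eqP => [->|_]; rewrite ?mulr0 // big_set0 mulr1.
rewrite /letter_op mulr_sumr; apply: eq_bigr => x xY.
by rewrite IH (big_setD1 x xY) /=; ring.
Qed.

(** The variable [w] of the letter [b] is chosen before all others; its kernel factors are then
    absorbed by the other letters, with the order of arguments dictated by their position in the
    word. *)
Lemma word_sum_pull u b v X :
  word_sum (u ++ b :: v) X = \sum_(w in X) b w *
    word_sum ([seq (fun x => ph x * G x w) | ph <- u]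
              ++ [seq (fun x => ph x * G w x) | ph <- v]) (X :\ w).
Proof.
elim: u X => [|ph u IH] X /=.
  by apply: eq_bigr => w wX; rewrite word_sum_mul mulrA.
rewrite {1}/letter_op.
transitivity (\sum_(x in X) \sum_(w in X | w != x)
   ph x * (G x w * \prod_(y in X :\ x :\ w) G x y) * (b w *
    word_sum ([seq (fun x => ph x * G x w) | ph <- u]
              ++ [seq (fun x => ph x * G w x) | ph <- v]) (X :\ x :\ w))).
  apply: eq_bigr => x xX; rewrite IH mulr_sumr.
  apply: eq_big => [w|w]; first by rewrite !inE andbC.
  by move=> wX; rewrite (big_setD1 w).
rewrite (exchange_big_dep (mem X)) /=; last by move=> x w _ /andP[].
apply: eq_bigr => w wX; rewrite mulr_sumr.
apply: eq_big => [x|x]; first by rewrite wX /= !inE eq_sym andbC.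
move=> _; have -> : X :\ x :\ w = X :\ w :\ x by rewrite !setDDl setUC.
ring.
Qed.

End WordSum.

Lemma rmorph_word_sum (K L : comNzRingType) (f : {rmorphism K -> L}) (T : finType)
    (G : T -> T -> K) (u : seq (T -> K)) X :
  f (word_sum G u X)
    = word_sum (fun x y => f (G x y)) [seq (fun x => f (ph x)) | ph <- u] X.
Proof.
elim: u X => [|ph u IH] X /=; first by rewrite rmorph_nat.
rewrite rmorph_sum; apply: eq_bigr => x _.
by rewrite !rmorphM rmorph_prod IH.
Qed.

(** * Enumerations as bijections, and symmetrization over positions *)

Section Symmetrization.
Variables (K : comNzRingType) (T : finType) (G : T -> T -> K).
Implicit Types (X Y : {set T}).

Definition enumerates (m : nat) Y (f : {ffun 'I_m -> T}) : bool :=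
  injectiveb f && (f @: setT == Y).

Let fcons m (p : T * {ffun 'I_m -> T}) : {ffun 'I_m.+1 -> T} :=
  [ffun i => oapp p.2 p.1 (unlift ord0 i)].

Let fcons0 m p : @fcons m p ord0 = p.1.
Proof. by rewrite ffunE unlift_none. Qed.

Let fconsS m p i : @fcons m p (lift ord0 i) = p.2 i.
Proof. by rewrite ffunE liftK. Qed.

Let fcons_bij m : bijective (@fcons m).
Proof.
exists (fun f : {ffun 'I_m.+1 -> T} =>
  (f ord0, [ffun i : 'I_m => f (lift ord0 i)])) => [[x f]|f] /=.
  rewrite fcons0; congr (_, _); apply/ffunP => i.
  by rewrite ffunE fconsS.
apply/ffunP => i; case: (unliftP ord0 i) => [j|] ->.
  by rewrite fconsS ffunE.
by rewrite fcons0.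
Qed.

Let enumerates_cons m Y x (f : {ffun 'I_m -> T}) :
  enumerates Y (fcons (x, f)) = (x \in Y) && enumerates (Y :\ x) f.
Proof.
have im : fcons (x, f) @: setT = x |: f @: setT.
  apply/setP => y; rewrite !inE; apply/imsetP/orP.
    case=> i _ ->; case: (unliftP ord0 i) => [j|] ->.
      by right; rewrite fconsS imset_f.
    by left; rewrite fcons0.
  case=> [/eqP ->|/imsetP[j _ ->]]; first by exists ord0; rewrite ?fcons0.
  by exists (lift ord0 j); rewrite ?fconsS.
have inj : injectiveb (fcons (x, f)) = (x \notin f @: setT) && injectiveb f.
  apply/injectiveP/andP => [fi|[xf /injectiveP fi] i j].
    split; last first.
      by apply/injectiveP => i j eij; apply: (@lift_inj _ ord0); apply: fi; rewrite !fconsS.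
    apply/imsetP => -[i _ ei]; have := fi ord0 (lift ord0 i).
    by rewrite fcons0 fconsS => /(_ ei) /eqP; rewrite (negbTE (neq_lift _ _)).
  case: (unliftP ord0 i) => [i'|] ->; case: (unliftP ord0 j) => [j'|] -> //;
    rewrite ?fcons0 ?fconsS /= => e.
  - by rewrite (fi _ _ e).
  - by rewrite -e imset_f in xf.
  - by rewrite e imset_f in xf.
rewrite /enumerates inj im; apply/andP/andP => [[/andP[xf fi] /eqP <-]|].
  by rewrite setU11 fi setU1K //= eqxx.
by case=> xY /andP[fi /eqP ->]; rewrite fi !inE eqxx setD1K.
Qed.

(** The recursion hides the positions of the word; an explicit sum over bijections from positions to
    variables lets permutations of the positions act. *)
Lemma word_sum_enum m (ph : 'I_m -> T -> K) Y :
  word_sum G [seq ph i | i <- enum 'I_m] Y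
    = \sum_(f : {ffun 'I_m -> T} | enumerates Y f)
        (\prod_(i < m) \prod_(j < m | (i < j)%N) G (f i) (f j))
        * \prod_(i < m) ph i (f i).
Proof.
elim: m ph Y => [|m IH] ph Y.
  rewrite (size0nil (size_enum_ord 0)) /=.
  have f0 (f : {ffun 'I_0 -> T}) : enumerates Y f = (Y == set0).
    rewrite /enumerates (_ : f @: setT = set0) 1?eq_sym ?andb_idl //.
      by move=> _; apply/injectiveP => -[].
    by apply/setP => y; rewrite !inE; apply/imsetP => -[[]].
  rewrite (eq_bigl _ _ f0); case: eqP => _; last by rewrite big_pred0.
  rewrite (eq_bigr (fun=> 1)) => [|f _]; last by rewrite !big_ord0 mulr1.
  by rewrite sumr_const card_ffun card_ord expn0.
rewrite enum_ordSl /= -map_comp /letter_op.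
rewrite (reindex (@fcons m)) /=; last exact/onW_bij/fcons_bij.
rewrite (eq_bigl (fun p => (p.1 \in Y) && enumerates (Y :\ p.1) p.2)); last first.
  by case=> x f; rewrite enumerates_cons.
rewrite -(pair_big_dep (mem Y) (fun x f => enumerates (Y :\ x) f)
  (fun x f => (\prod_(i < m.+1) \prod_(j < m.+1 | (i < j)%N)
      G (fcons (x, f) i) (fcons (x, f) j)) * \prod_(i < m.+1) ph i (fcons (x, f) i))) /=.
apply: eq_bigr => x xY; rewrite IH mulr_sumr; apply: eq_bigr => f /andP[/injectiveP fi /eqP fY].
have e0 : \prod_(j < m.+1 | ((ord0 : 'I_m.+1) < j)%N) G (fcons (x, f) ord0) (fcons (x, f) j)
    = \prod_(y in Y :\ x) G x y.
  rewrite [LHS]big_mkcond [LHS]big_ord_recl /= mul1r fcons0 -fY big_imset /=;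
      last by move=> i j _ _ /fi.
  by apply: eq_big => [i|i _]; rewrite ?inE ?fconsS.
have e1 (i : 'I_m) : \prod_(j < m.+1 | (lift ord0 i < j)%N)
    G (fcons (x, f) (lift ord0 i)) (fcons (x, f) j) = \prod_(j < m | (i < j)%N) G (f i) (f j).
  rewrite [LHS]big_mkcond [LHS]big_ord_recl /= mul1r [RHS]big_mkcond.
  by apply: eq_bigr => j _; rewrite !fconsS.
rewrite [in RHS]big_ord_recl e0 (eq_bigr _ (fun i _ => e1 i)).
rewrite [\prod_(i < m.+1) ph i _]big_ord_recl fcons0 /=.
have e2 (i : 'I_m) : ph (lift ord0 i) (fcons (x, f) (lift ord0 i)) = ph (lift ord0 i) (f i).
  by rewrite fconsS.
rewrite (eq_bigr _ (fun i _ => e2 i)).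
ring.
Qed.

(* Summing over all the ways to distribute the factors [kap] makes them
   independent of the enumeration, so that they factor out. *)
Lemma word_sum_sym m (kap : 'I_m -> T -> K) Y : exists P : K,
  forall chi : 'I_m -> T -> K,
  \sum_(t : 'S_m) word_sum G [seq (fun x => chi i x * kap (t i) x) | i <- enum 'I_m] Y
    = P * word_sum G [seq chi i | i <- enum 'I_m] Y.
Proof.
pose P (f : {ffun 'I_m -> T}) := \sum_(t : 'S_m) \prod_i kap (t i) (f i).
(* Two enumerations of [Y] differ by a permutation [g] of the positions, which the sum over [t]
   absorbs. *)
have eP f0 f : enumerates Y f0 -> enumerates Y f -> P f = P f0.
  move=> /andP[/injectiveP i0 /eqP Y0] /andP[/injectiveP fi /eqP fY].
  have ex i : exists j, f0 j == f i.
    have : f i \in f0 @: setT by rewrite Y0 -fY imset_f.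
    by case/imsetP => j _ ->; exists j.
  pose g i := xchoose (ex i).
  have gE i : f0 (g i) = f i by apply/eqP/(xchooseP (ex i)).
  have gi : injective g by move=> i j e; apply: fi; rewrite -!gE e.
  rewrite /P (reindex_inj (mulgI (perm gi))) /=; apply: eq_bigr => t _.
  rewrite [RHS](reindex_inj (@perm_inj _ (perm gi))) /=; apply: eq_bigr => i _.
  by rewrite permM permE gE.
(* If [Y] has no enumeration of length [m], both word sums are empty and the default 0 is
   harmless. *)
pose f0 := [pick f : {ffun 'I_m -> T} | enumerates Y f].
exists (if f0 is Some f then P f else 0) => chi.
rewrite word_sum_enum mulr_sumr.
under eq_bigr do rewrite word_sum_enum.
rewrite exchange_big /=; apply: eq_bigr => f hf.
have -> : (if f0 is Some f then P f else 0) = P f.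
  by rewrite /f0; case: pickP => [f1 h1|/(_ f)]; [rewrite (eP f1) | rewrite hf].
rewrite /P mulr_suml; apply: eq_bigr => t _.
by rewrite big_split /=; ring.
Qed.

End Symmetrization.

(** * Letters as linear operators *)

Section LetterOperator.
Variables (K : fieldType) (T : finType) (G : T -> T -> K).
Local Notation state := {ffun {set T} -> K^o}.

(** Finite functions form a module, and the quantum-plane identity is about linear endomorphisms of
    a module. *)
Definition letter_ffun (ph : T -> K) (f : state) : state :=
  [ffun Y => letter_op G ph f Y].

Lemma letter_ffun_is_linear ph : linear (letter_ffun ph).
Proof.
move=> a f g; apply/ffunP => Y; rewrite !ffunE /letter_op scaler_sumr -big_split.
apply: eq_bigr => x _; rewrite !ffunE mulrDr; congr (_ + _).
exact: mulrCA.
Qed.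

HB.instance Definition _ ph :=
  GRing.isLinear.Build K state state *:%R (letter_ffun ph) (letter_ffun_is_linear ph).

Lemma letter_ffunB (ph psi ph' : T -> K) (a b : K) (f : state) :
  (forall x, ph' x = a * ph x - b * psi x) ->
  letter_ffun ph' f = a *: letter_ffun ph f - b *: letter_ffun psi f.
Proof.
move=> e; apply/ffunP => Y; rewrite !ffunE /letter_op !scaler_sumr -sumrB.
by apply: eq_bigr => x _; rewrite e -!/(_ * _); rewrite /GRing.scale /=; ring.
Qed.

Lemma word_sum_nseq2 (ph psi : T -> K) s t Y :
  word_sum G (nseq s ph ++ nseq t psi) Y
    = iter s (letter_ffun ph) (iter t (letter_ffun psi) [ffun X => (X == set0)%:R]) Y.
Proof.
have h (chi : T -> K) k u (f : state) : (forall X, word_sum G u X = f X) ->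
   forall X, word_sum G (nseq k chi ++ u) X = iter k (letter_ffun chi) f X.
  elim: k => [|k IH] uf X //=; rewrite ffunE.
  by apply: letter_op_ext => // x _; apply: IH.
apply: (h) => X; rewrite -[nseq t psi]cats0; apply: (h) => {}X.
by rewrite ffunE.
Qed.

End LetterOperator.

(** * A q-binomial identity in the quantum plane *)

(** This is the image under [v -> v^-1] of the Pascal rule that defines [qbinom]. Both rules are
    needed below, and the induction avoids dividing by [[k]_v]. *)
Lemma qbinomS_sym (K : fieldType) (v : K) n p : v != 0 ->
  qbinom v n.+1 p.+1
    = v ^ (- p.+1%:Z) * qbinom v n p.+1 + v ^ (n%:Z - p%:Z) * qbinom v n p.
Proof.
move=> v0; elim: n p => [|n IH] p.
  case: p => [|p] /=; first by rewrite !mulr0 !add0r !subrr.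
  by rewrite !mulr0 !addr0.
have e1 k : qbinom v n.+2 k.+1 = v ^ k.+1%:Z * qbinom v n.+1 k.+1
   + v ^ (k.+1%:Z - n.+2%:Z) * qbinom v n.+1 k by [].
have e2 k : qbinom v n.+1 k.+1 = v ^ k.+1%:Z * qbinom v n k.+1
   + v ^ (k.+1%:Z - n.+1%:Z) * qbinom v n k by [].
rewrite [LHS]e1 [in LHS](IH p) [in RHS](e2 p) !mulrDr !mulrA -!expfzDr //.
rewrite addrN addNr -!addrA; congr (_ + _).
case: p => [|p].
  rewrite !qbinom0 !mulr1 addrC; congr (v ^ _ + v ^ _); lia.
rewrite [in LHS](IH p) [in RHS](e2 p) !mulrDr !mulrA -!expfzDr // !addrA.
congr (_ + _ * _); last by congr (v ^ _); lia.
by rewrite addrC; congr (v ^ _ * _ + v ^ _ * _); lia.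
Qed.

Section QuantumPlane.
Variables (K : fieldType) (V : lmodType K) (x y : {linear V -> V}) (v : K).
Hypothesis v0 : v != 0.
Hypothesis yx : forall f, y (x f) = v ^+ 2 *: x (y f).
Implicit Types (f : V) (a b c la mu : K).

Let ell la f := y f - la *: x f.

Let ellD la : {morph ell la : f g / f + g}.
Proof. by move=> f g; rewrite /ell !raddfD /= addrACA. Qed.
Let ellZ la c : {morph ell la : f / c *: f}.
Proof.
move=> f; rewrite /ell scalerBr scalerA mulrC -scalerA.
by congr (_ - _ *: _); rewrite linearZ.
Qed.
Let ell0 la : ell la 0 = 0.
Proof. by have := ellZ la 0 0; rewrite !scale0r. Qed.

Let iter_yx j f : iter j y (x f) = v ^+ (2 * j) *: x (iter j y f).
Proof.
elim: j => [|j IH]; first by rewrite muln0 scale1r.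
by rewrite !iterS IH linearZ /= yx scalerA -exprD mulnS addnC.
Qed.

Let y_iterx k f : y (iter k x f) = v ^+ (2 * k) *: iter k x (y f).
Proof.
elim: k => [|k IH]; first by rewrite muln0 scale1r.
by rewrite !iterS yx IH linearZ /= scalerA -exprD mulnS.
Qed.

Let iterZ (g : V -> V) (hg : forall c, {morph g : f / c *: f}) k c f :
  iter k g (c *: f) = c *: iter k g f.
Proof. by elim: k => //= k ->; rewrite hg. Qed.

Let iterB (g : {linear V -> V}) k f f' :
  iter k g (f - f') = iter k g f - iter k g f'.
Proof. by elim: k => //= k ->; rewrite linearB. Qed.

(* Coefficient of x^k y^(m-k) when the left-hand side of [qplane_sum] is
   normally ordered by y x = v^2 x y. *)
Definition qplane_coef la mu (m : nat) c (k : nat) : K :=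
  (-1) ^+ k * qbinom v m k * v ^+ (k * (m - k))
  * \prod_(j < m - k) (1 - c * v ^ (m%:Z - 1 - j%:Z *+ 2))
  * \prod_(j < k) (mu - c * la * v ^ (1 - m%:Z + j%:Z *+ 2)).

Let coef0 la mu m c :
  qplane_coef la mu m.+1 c 0
    = qplane_coef la mu m (c * v) 0 * (1 - c * v ^ (- m%:Z)).
Proof.
rewrite /qplane_coef !big_ord0 !qbinom0 !mul0n !expr0 !mulr1 !mul1r !subn0.
rewrite big_ord_recr /=; congr (_ * _); last by congr (1 - c * v ^ _); lia.
apply: eq_bigr => j _; rewrite -mulrA -{2}[v]expr1z -expfzDr //.
by congr (1 - c * v ^ _); lia.
Qed.

(** In [S_rec] the new factor acts either first, as [ell mu], or last, as [ell la]. The first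
    summand comes from its [y] part, the second from its [x] part; the powers of [v] come from
    normal ordering. *)
Let coefS la mu m c k : (k <= m)%N ->
  qplane_coef la mu m.+1 c k.+1
    = qplane_coef la mu m (c * v) k.+1 * (1 - c * v ^ (k.+1%:Z *+ 2 - m%:Z))
      - qplane_coef la mu m (c * v) k
        * (mu * v ^+ (2 * (m - k)) - c * v ^ (- m%:Z) * la).
Proof.
move=> km; rewrite /qplane_coef subSS; set qb := qbinom v m.+1 k.+1.
set P := \prod_(j < m - k) (1 - c * v ^ (m.+1%:Z - 1 - j%:Z *+ 2)).
have eP (l : nat) : \prod_(j < l) (1 - c * v * v ^ (m%:Z - 1 - j%:Z *+ 2))
     = \prod_(j < l) (1 - c * v ^ (m.+1%:Z - 1 - j%:Z *+ 2)).
  apply: eq_bigr => j _; rewrite -mulrA -{1}[v]expr1z -expfzDr //.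
  by congr (1 - c * v ^ _); lia.
set Q := \prod_(j < k) (mu - c * v * la * v ^ (1 - m%:Z + j%:Z *+ 2)).
rewrite big_ord_recl [\prod_(j < k) _](_ : _ = Q); last first.
  apply: eq_bigr => j _; rewrite [c * v * la]mulrAC -[_ * v * _]mulrA.
  rewrite -{2}[v]expr1z -expfzDr //.
  by congr (_ - c * la * v ^ _); rewrite /= /bump /=; lia.
rewrite [\prod_(j < k.+1) _]big_ord_recr /= -/Q !eP -/P.
set P' := \prod_(j < m - k.+1) _; set t := 1 - c * v ^ _; set X := mu - c * v * la * _.
(* [t] is the last factor of [P] when [k < m]; for [k = m] there is no such factor, but then the
   binomial vanishes. *)
have hP : qbinom v m k.+1 * (P' * t) = qbinom v m k.+1 * P.
  case: (ltnP k m) => [lkm|mk]; last by rewrite qbinom_small // !mul0r.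
  have hmk : (m - k = (m - k.+1).+1)%N by lia.
  rewrite /P' /P /t hmk big_ord_recr /=; congr (_ * (_ * (1 - c * v ^ _))); lia.
(* What remains after removing the common factors [P] and [Q]. The part in [mu] is the mirrored
   Pascal rule ([m1]), the part in [la] the defining one ([m2]). *)
have key : qb * v ^+ (k.+1 * (m - k)) * (mu - c * la * v ^ (- m%:Z))
  = qbinom v m k.+1 * v ^+ (k.+1 * (m - k.+1)) * X
    + qbinom v m k * v ^+ (k * (m - k)) * (mu * v ^+ (2 * (m - k)) - c * v ^ (- m%:Z) * la).
  have vS i : v * v ^ i = v ^ (1 + i) by rewrite expfzDr // expr1z.
  have m1 : qb * v ^+ (k.+1 * (m - k)) = qbinom v m k.+1 * v ^+ (k.+1 * (m - k.+1))
      + qbinom v m k * v ^+ (k * (m - k)) * v ^+ (2 * (m - k)).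
    rewrite /qb qbinomS_sym // mulrDl; congr (_ + _).
      case: (ltnP k m) => [lkm|mk]; last by rewrite qbinom_small // mulr0 !mul0r.
      have -> : (m - k = (m - k.+1).+1)%N by lia.
      by rewrite mulrAC mulrC mulnS !exprnP -expfzDr //; congr (_ * v ^ _); lia.
    rewrite mulrAC mulrC -mulrA; congr (_ * _).
    by rewrite !exprnP -!expfzDr //; congr (v ^ _); lia.
  have m2 : qb * v ^+ (k.+1 * (m - k)) * v ^ (- m%:Z)
     = qbinom v m k.+1 * v ^+ (k.+1 * (m - k.+1)) * (v * v ^ (1 - m%:Z + k%:Z *+ 2))
      + qbinom v m k * v ^+ (k * (m - k)) * v ^ (- m%:Z).
    have -> : qb = v ^ k.+1%:Z * qbinom v m k.+1 + v ^ (k.+1%:Z - m.+1%:Z) * qbinom v m k by [].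
    rewrite mulrDl mulrDl; congr (_ + _).
      case: (ltnP k m) => [lkm|mk]; last by rewrite qbinom_small // mulr0 !mul0r.
      have -> : (m - k = (m - k.+1).+1)%N by lia.
      rewrite mulnS -!mulrA mulrCA; congr (_ * _).
      by rewrite !exprnP vS -!expfzDr //; congr (v ^ _); lia.
    rewrite -!mulrA mulrCA; congr (_ * _).
    by rewrite !exprnP -!expfzDr //; congr (v ^ _); lia.
  transitivity (mu * (qb * v ^+ (k.+1 * (m - k)))
     - c * la * (qb * v ^+ (k.+1 * (m - k)) * v ^ (- m%:Z))); first by ring.
  by rewrite m2 m1 /X; ring.
transitivity ((-1) ^+ k.+1 * (qb * v ^+ (k.+1 * (m - k)) * (mu - c * la * v ^ (- m%:Z))) * P * Q).
  have -> : mu - c * la * v ^ (1 - m.+1%:Z + (ord0 : 'I_k.+1)%:Z *+ 2) = mu - c * la * v ^ (- m%:Z).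
    by congr (_ - _ * v ^ _) => /=; lia.
  by rewrite !mulrA; ring.
rewrite key exprS.
transitivity (-1 * (-1) ^+ k * v ^+ (k.+1 * (m - k.+1)) * (qbinom v m k.+1 * (P' * t)) * (Q * X)
  - (-1) ^+ k * qbinom v m k * v ^+ (k * (m - k)) * P * Q
      * (mu * v ^+ (2 * (m - k)) - c * v ^ (- m%:Z) * la)).
  by rewrite hP; ring.
ring.
Qed.

Let S m c la mu f := \sum_(s < m.+1) ((-1) ^+ s * c ^+ s * qbinom v m s) *:
   iter s (ell la) (iter (m - s) (ell mu) f).

(** The parameter [c] exists for this induction: the Pascal rule multiplies the term of index [s] by
    [v ^ s], which amounts to replacing [c] by [c * v]. *)
Let S_rec m c la mu f :
  S m.+1 c la mu f = S m (c * v) la mu (ell mu f)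
     - (c * v ^ (- m%:Z)) *: ell la (S m (c * v) la mu f).
Proof.
rewrite /S big_ord_recl /=.
transitivity ((\sum_(s < m.+2) ((-1) ^+ s * (c * v) ^+ s * qbinom v m s) *:
    iter s (ell la) (iter (m.+1 - s) (ell mu) f))
  + \sum_(s < m.+1) ((-1) ^+ s.+1 * c ^+ s.+1 * v ^ (s%:Z - m%:Z) * qbinom v m s) *:
    iter s.+1 (ell la) (iter (m - s) (ell mu) f)).
  rewrite [in RHS]big_ord_recl /= -addrA; congr (_ + _).
    by rewrite !expr0 qbinom0 !mul1r.
  rewrite -big_split; apply: eq_bigr => s _; rewrite /bump /= add1n subSS -scalerDl.
  congr (_ *: _); rewrite [(c * v) ^+ _]exprMn_comm; last exact: mulrC.
  have -> : v ^ (s.+1%:Z - m.+1%:Z) = v ^ (s%:Z - m%:Z) by congr (v ^ _); lia.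
  by rewrite -exprnP; ring.
congr (_ + _).
  rewrite big_ord_recr /= qbinom_small // mulr0 scale0r addr0.
  apply: eq_bigr => s _; have sm : (s <= m)%N by rewrite -ltnS.
  by rewrite (subSn sm) iterSr.
have ell_sum : ell la (\sum_(s < m.+1) ((-1) ^+ s * (c * v) ^+ s * qbinom v m s) *:
   iter s (ell la) (iter (m - s) (ell mu) f))
    = \sum_(s < m.+1) ((-1) ^+ s * (c * v) ^+ s * qbinom v m s) *:
   iter s.+1 (ell la) (iter (m - s) (ell mu) f).
  rewrite (big_morph (ell la) (ellD la) (ell0 la)).
  by apply: eq_bigr => s _; rewrite ellZ.
rewrite ell_sum scaler_sumr -sumrN; apply: eq_bigr => s _.
rewrite scalerA -scaleNr; congr (_ *: _).
rewrite [(c * v) ^+ _]exprMn_comm; last exact: mulrC.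
rewrite addrC expfzDr // -exprnP !exprS; ring.
Qed.

Lemma qplane_sum m c la mu f :
  \sum_(s < m.+1) ((-1) ^+ s * c ^+ s * qbinom v m s) *:
     iter s (fun g => y g - la *: x g) (iter (m - s) (fun g => y g - mu *: x g) f)
  = \sum_(k < m.+1) qplane_coef la mu m c k *: iter k x (iter (m - k) y f).
Proof.
rewrite -/(S m c la mu f); elim: m c f => [|m IH] c f.
  by rewrite /S !big_ord1 /= /qplane_coef /= !big_ord0 !mulr1.
rewrite S_rec !IH.
(* The normally ordered monomials of degree [m.+1]; bringing the new [x] or [y] into place costs the
   powers of [v] in [iter_yx] and [y_iterx]. *)
pose E k := iter k x (iter (m.+1 - k) y f).
transitivity (\sum_(k < m.+2) (qplane_coef la mu m (c * v) k
     * (1 - c * v ^ (k%:Z *+ 2 - m%:Z))) *: E k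
  - \sum_(k < m.+1) (qplane_coef la mu m (c * v) k
        * (mu * v ^+ (2 * (m - k)) - c * v ^ (- m%:Z) * la)) *: E k.+1).
  rewrite [in RHS]big_ord_recr /= [X in (X * _) *: E m.+1](_ : _ = 0); last first.
    by rewrite /qplane_coef qbinom_small // mulr0 !mul0r.
  rewrite mul0r scale0r addr0 -sumrB.
  rewrite (big_morph (ell la) (ellD la) (ell0 la)).
  rewrite scaler_sumr -sumrB; apply: eq_bigr => k _.
  have km : (k <= m)%N by rewrite -ltnS.
  have eA : iter k x (iter (m - k) y (ell mu f))
     = E k - (mu * v ^+ (2 * (m - k))) *: E k.+1.
    rewrite /ell iterB iterB iterZ; last by move=> c'; exact: linearZ.
    rewrite iter_yx iterZ; last by move=> c'; exact: linearZ.
    rewrite iterZ; last by move=> c'; exact: linearZ.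
    by rewrite scalerA -iterSr -iterSr /E subSn // subSS.
  have eB : ell la (iter k x (iter (m - k) y f))
     = v ^+ (2 * k) *: E k - la *: E k.+1.
    by rewrite /ell y_iterx -!iterS /E subSn // subSS.
  rewrite ellZ eA eB scalerBr !scalerA scalerBr !scalerA.
  have -> : v ^ (k%:Z *+ 2 - m%:Z) = v ^+ (2 * k) * v ^ (- m%:Z).
    by rewrite exprnP -expfzDr //; congr (v ^ _); lia.
  rewrite opprB [X in _ + X]addrC addrACA -!scaleNr -!scalerDl.
  by congr (_ *: _ + _ *: _); ring.
rewrite [in RHS]big_ord_recl /= coef0.
rewrite [in LHS]big_ord_recl /= -addrA; congr (_ *: _ + _).
  by rewrite mul0rn sub0r.
rewrite -sumrB; apply: eq_bigr => k _.
have km : (k <= m)%N by rewrite -ltnS.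
by rewrite /bump /= add1n (coefS _ _ _ km) -/(E k.+1) -scalerBl.
Qed.

(** Each coefficient has a vanishing factor of index [j = 0]: it is [1 - c * v ^ (m - 1)] when
    [k < m], and [mu - c * la * v ^ (1 - m)] when [k = m]. *)
Let qplane_coef_eq0 m k : (0 < m)%N -> (k <= m)%N ->
  qplane_coef (v ^ (1 - m%:Z))^-1 (v ^ (1 - m%:Z)) m (v ^ (1 - m%:Z)) k = 0.
Proof.
move=> m0; set u := v ^ _; have u0 : u != 0 by rewrite expfz_neq0.
rewrite /qplane_coef leq_eqVlt => /orP[/eqP ->|km].
  rewrite (bigD1 (Ordinal m0)) //= mul0rn addr0 -/u divff // mul1r subrr.
  by rewrite mul0r mulr0.
have km' : (0 < m - k)%N by rewrite subn_gt0.
rewrite (bigD1 (Ordinal km')) //= mul0rn subr0 -expfzDr //.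
have -> : v ^ (1 - m%:Z + (m%:Z - 1)) = 1.
  by rewrite -[RHS](expr0z v); congr (v ^ _); lia.
by rewrite subrr mul0r mulr0 mul0r.
Qed.

Lemma qplane_serre m (f : V) : (0 < m)%N ->
  \sum_(s < m.+1) ((-1) ^+ s * qbinom v m s) *:
     iter s (fun g => v ^ (1 - m%:Z) *: y g - x g)
       (iter (m - s) (fun g => y g - v ^ (1 - m%:Z) *: x g) f) = 0.
Proof.
move=> m0; set u := v ^ (1 - m%:Z).
have u0 : u != 0 by rewrite expfz_neq0.
(* Writing [u *: y - x] as [u *: (y - u^-1 *: x)] in the [s] outer operators produces [u ^+ s]; this
   is the case [c = u], [la = u^-1], [mu = u] of [qplane_sum]. *)
transitivity (\sum_(s < m.+1) ((-1) ^+ s * u ^+ s * qbinom v m s) *: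
     iter s (fun g => y g - u^-1 *: x g) (iter (m - s) (fun g => y g - u *: x g) f)).
  apply: eq_bigr => s _; move: (iter (m - s) _ f) => g.
  have -> : iter s (fun g => u *: y g - x g) g = u ^+ s *: iter s (fun g => y g - u^-1 *: x g) g.
    elim: (s : nat) => [|k IH]; first by rewrite scale1r.
    rewrite !iterS IH -/(ell u^-1 _) -{1}[x _](scalerKV u0) -scalerBr -/(ell u^-1 _).
    by rewrite ellZ scalerA exprS.
  by rewrite scalerA mulrAC.
rewrite qplane_sum big1 // => k _.
by rewrite qplane_coef_eq0 ?scale0r // -ltnS.
Qed.

End QuantumPlane.

(** * Quadratic and Serre relations *)

Lemma rmorph_qbinom (F K : fieldType) (f : {rmorphism F -> K}) v n p :
  f (qbinom v n p) = qbinom (f v) n p.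
Proof.
elim: n p => [|n IH] [|p] /=; rewrite ?rmorph1 ?rmorph0 //.
by rewrite rmorphD !rmorphM !fmorphXz !IH.
Qed.

Lemma filter_enum_ord_split m s :
  [seq i : 'I_m <- enum 'I_m | (i < s)%N] ++ [seq i : 'I_m <- enum 'I_m | (s <= i)%N] = enum 'I_m.
Proof.
apply: (inj_map val_inj); rewrite map_cat.
rewrite -(filter_map val (fun i => (i < s)%N)) -(filter_map val (leq s)) val_enum_ord.
elim: m 0%N => [|m IH] k //=; rewrite ltnNge; case: leqP => sk /=; last by rewrite IH.
have ge i : i \in iota k.+1 m -> (s <= i)%N.
  by rewrite mem_iota => /andP[/ltnW ki _]; apply: leq_trans sk ki.
rewrite (eq_in_filter (a2 := pred0)) => [|i /ge]; last by rewrite ltnNge => ->.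
by rewrite filter_pred0 (eq_in_filter (a2 := predT)) ?filter_predT // => i /ge ->.
Qed.

Section Kernel.
Variables (K : comNzRingType) (r N : nat) (c : 'I_N -> 'I_r).
Variables (kap : 'I_r -> 'I_r -> K) (e : K) (z : 'I_N -> K).

(* The sign absorbs both the signature in the shuffle product and the
   Vandermonde of the prefactor, so that no denominator z_i - z_j is needed. *)
Definition kern (x y : 'I_N) : K :=
  (-1) ^+ (y < x)%N * (kap (c x) (c y) * z y - e * z x).

End Kernel.

Section Relations.
Variables (F K : fieldType) (emb : {rmorphism F -> K}).
Variables (r : nat) (A : 'M[int]_r) (d : 'I_r -> nat) (q : F).
Hypothesis q0 : q != 0.
Hypothesis Adiag : forall i, A i i = 2.
Hypothesis Aoff : forall i j, i != j -> (A i j <= 0)%R.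
Hypothesis Asym : forall i j, (d i)%:Z * A i j = (d j)%:Z * A j i.
Hypothesis two_neq0 : 2 != 0 :> K.
Variables (N : nat) (c : 'I_N -> 'I_r) (z : 'I_N -> K).
Hypothesis z0 : forall x, z x != 0.
Implicit Types (a b : 'I_r) (k l : int) (X Y : {set 'I_N}) (Phi : {set 'I_N} -> K).

Let kap a b := emb (q ^ Defs.form A d a b).
Let G := kern c kap 1 z.

Definition letter (p : 'I_r * int) (x : 'I_N) : K :=
  if c x == p.1 then z x ^ p.2 else 0.

Let kapC a b : kap a b = kap b a.
Proof. by rewrite /kap /Defs.form Asym. Qed.

(** Both sides are, up to sign, the product of the two q-differences of the pair; the signs agree
    because exactly one of [x < y] and [y < x] holds. *)
Let G_swap x y : x != y ->
  (kap (c x) (c y) * z x - z y) * G x y = (z x - kap (c x) (c y) * z y) * G y x.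
Proof.
rewrite /G /kern (kapC (c y)) => xy.
have -> : (x < y)%N = ~~ (y < x)%N by rewrite -leqNgt ltn_neqAle (inj_eq val_inj) xy.
move: (kap _ _) (z x) (z y) => k zx zy.
by case: ltnP => _ /=; rewrite ?expr0 ?expr1; ring.
Qed.

(** The continuation [Phi] is arbitrary so that, for [a = b], this becomes a commutation rule
    between operators in the proof of the Serre relations. *)
Lemma letter_quad a b k l Phi X :
  kap a b * letter_op G (letter (a, k + 1)) (letter_op G (letter (b, l)) Phi) X
  - letter_op G (letter (a, k)) (letter_op G (letter (b, l + 1)) Phi) X
  = letter_op G (letter (b, l)) (letter_op G (letter (a, k + 1)) Phi) X
  - kap a b * letter_op G (letter (b, l + 1)) (letter_op G (letter (a, k)) Phi) X.
Proof.
rewrite !letter_op2 !mulr_sumr -!sumrB.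
rewrite [RHS](reindex (fun p => (p.2, p.1))) /=; last first.
  by exists (fun p => (p.2, p.1)) => -[].
apply: eq_big => [[x y]|[x y] /= /and3P[xX yX xy]]; first by rewrite /= eq_sym andbCA.
have -> : X :\ y :\ x = X :\ x :\ y by rewrite !setDDl setUC.
have -> : \prod_(w in X :\ x :\ y) (G y w * G x w) = \prod_(w in X :\ x :\ y) (G x w * G y w).
  by apply: eq_bigr => w _; rewrite mulrC.
set R := \prod_(w in _) _; rewrite /letter /=.
case: eqP => [<-|_]; last by rewrite !(mul0r, mulr0, subrr).
case: eqP => [<-|_]; last by rewrite !(mul0r, mulr0, subrr).
rewrite !expfzDr ?z0 // -?exprnP !expr1.
transitivity (z x ^ k * z y ^ l * ((kap (c x) (c y) * z x - z y) * G x y) * R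
    * Phi (X :\ x :\ y)); first by ring.
by rewrite G_swap //; ring.
Qed.

(** The Serre relation once the variable [w] of color [b] is fixed and all exponents of the
    [a]-letters are 0; general exponents are recovered by symmetrization. *)
Let letter_serre_lin a b w Y : a != b -> c w = b -> w \notin Y ->
  \sum_(s < (serre_len A a b).+1)
    emb ((-1) ^+ s * qbinom (q ^+ d a) (serre_len A a b) s) *
    word_sum G [seq (fun x => letter (a, 0) x * (if (i < s)%N then G x w else G w x))
               | i : 'I_(serre_len A a b) <- enum 'I_(serre_len A a b)] Y = 0.
Proof.
move=> ab cw wY; set m := serre_len A a b.
pose v := emb (q ^+ d a); pose u := kap a b.
have v0 : v != 0 by rewrite fmorph_eq0 expf_neq0.
have m0 : (0 < m)%N by rewrite /m /serre_len; have := Aoff ab; lia.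
(* Since [m = 1 - a_ab], the constant of [qplane_serre] is exactly [q^(a,b)]. *)
have uE : u = v ^ (1 - m%:Z).
  rewrite /u /kap /v -fmorphXz; congr (emb _).
  rewrite exprnP exprz_exp /Defs.form; congr (q ^ (_ * _)).
  by rewrite /m /serre_len; have := Aoff ab; lia.
(* Up to the same sign [sg x], the kernel with [w] is [u * z w - z x] for a letter placed before [w]
   and [z w - u * z x] for one placed after. Both are combinations of the letters of exponents 0 and
   1. *)
pose Lp x := u * (z w * letter (a, 0) x) - 1 * letter (a, 1) x.
pose Lm x := 1 * (z w * letter (a, 0) x) - u * letter (a, 1) x.
pose sg x : K := (-1) ^+ (w < x)%N.
transitivity (\sum_(s < m.+1) emb ((-1) ^+ s * qbinom (q ^+ d a) m s) *
   ((\prod_(y in Y) sg y) * word_sum G (nseq s Lp ++ nseq (m - s) Lm) Y)).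
  apply: eq_bigr => s _; congr (_ * _); rewrite -word_sum_mul.
  have sm : (s <= m)%N by rewrite -ltnS.
  apply: eq_word_sum => [|i x].
    by rewrite [LHS]size_map size_enum_ord [RHS]size_map size_cat !size_nseq subnKC.
  rewrite size_map size_enum_ord => im xY.
  rewrite (nth_map (Ordinal im)) ?size_enum_ord // nth_enum_ord //.
  rewrite (nth_map (fun=> 0)) ?size_cat ?size_nseq ?subnKC //.
  have -> : nth (fun=> 0) (nseq s Lp ++ nseq (m - s) Lm) i = if (i < s)%N then Lp else Lm.
    rewrite nth_cat size_nseq !nth_nseq; case: ltnP => // si.
    by rewrite (_ : (i - s < m - s)%N) //; lia.
  have xw : (x < w)%N = ~~ (w < x)%N.
    by rewrite -leqNgt ltn_neqAle (inj_eq val_inj) (contraNneq _ wY) // => <-.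
  rewrite /Lp /Lm /letter; case: ltnP => _ /=;
    (case: eqP => [cx|_]; last by rewrite !(mul0r, mulr0, subr0));
    rewrite /G /kern /sg ?xw cw cx ?(kapC b a) -/u;
    rewrite expr0z expr1z; move: (z x) (z w) (u) => zx zw u';
    by case: ltnP => _ /=; rewrite ?expr0 ?expr1; ring.
transitivity ((\prod_(y in Y) sg y) * \sum_(s < m.+1)
   ((-1) ^+ s * qbinom v m s) * word_sum G (nseq s Lp ++ nseq (m - s) Lm) Y).
  rewrite mulr_sumr; apply: eq_bigr => s _.
  by rewrite rmorphM rmorphXn rmorphN1 rmorph_qbinom mulrCA.
pose lx := letter_ffun G (letter (a, 1)).
pose ly := letter_ffun G (fun x => z w * letter (a, 0) x).
have lyx f : ly (lx f) = v ^+ 2 *: lx (ly f).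
  apply/ffunP => X; rewrite !ffunE letter_opZl.
  have -> : letter_op G (letter (a, 0)) (lx f) X
      = letter_op G (letter (a, 0)) (letter_op G (letter (a, 1)) f) X.
    by apply: letter_op_ext => // x _; rewrite ffunE.
  have -> : letter_op G (letter (a, 1)) (ly f) X
      = z w * letter_op G (letter (a, 1)) (letter_op G (letter (a, 0)) f) X.
    rewrite -letter_opZr; apply: letter_op_ext => // x _.
    by rewrite ffunE letter_opZl.
  rewrite /GRing.scale /= mulrCA; congr (_ * _); apply/eqP; rewrite -subr_eq0.
  have : kap a a = v ^+ 2.
    rewrite /kap /v /Defs.form Adiag -rmorphXn; congr (emb _).
    by rewrite !exprnP exprz_exp; congr (q ^ _); lia.
  (* For equal colors and [k = l = 0] the quadratic relation is twice the wanted commutation rule,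
     whence the division by 2. *)
  have := letter_quad a a 0 0 f X; rewrite !add0r => /eqP; rewrite -subr_eq0 => eq kaa.
  have : 2 * (letter_op G (letter (a, 0)) (letter_op G (letter (a, 1)) f) X
     - v ^+ 2 * letter_op G (letter (a, 1)) (letter_op G (letter (a, 0)) f) X) == 0.
    by rewrite -oppr_eq0 -kaa; apply: etrans eq; congr (_ == _); ring.
  by rewrite mulf_eq0 (negbTE two_neq0).
have := @qplane_serre K _ lx ly v v0 lyx m [ffun X => (X == set0)%:R] m0.
rewrite -uE => /ffunP/(_ Y); rewrite !ffunE => e.
rewrite -[RHS](mulr0 (\prod_(y in Y) sg y)) -[in RHS]e; congr (_ * _).
rewrite sum_ffunE; apply: eq_bigr => s _; rewrite ffunE; congr (_ * _).
rewrite word_sum_nseq2; apply: (congr1 (fun f : {ffun {set 'I_N} -> K^o} => f Y)).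
rewrite (eq_iter (f' := fun g => u *: ly g - lx g)) => [|g]; last first.
  by rewrite (letter_ffunB G (a := u) (b := 1) g (fun=> erefl)) scale1r.
congr (iter _ _ _); apply: eq_iter => g.
by rewrite (letter_ffunB G (a := 1) (b := u) g (fun=> erefl)) scale1r.
Qed.

Lemma letter_serre a b (k : 'I_(serre_len A a b) -> int) l X : a != b ->
  \sum_(s < (serre_len A a b).+1)
    emb ((-1) ^+ s * qbinom (q ^+ d a) (serre_len A a b) s) *
    \sum_(t : 'S_(serre_len A a b))
      word_sum G ([seq letter (a, k (t i)) | i : 'I_(serre_len A a b)
                     <- enum 'I_(serre_len A a b) & (i < s)%N]
        ++ letter (b, l) ::
           [seq letter (a, k (t i)) | i : 'I_(serre_len A a b)
                     <- enum 'I_(serre_len A a b) & (s <= i)%N]) X = 0.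
Proof.
move=> ab; set m := serre_len A a b.
pose chi w (s : nat) (i : 'I_m) x := letter (a, 0) x * (if (i < s)%N then G x w else G w x).
transitivity (\sum_(w in X) letter (b, l) w * \sum_(s < m.+1)
    emb ((-1) ^+ s * qbinom (q ^+ d a) m s) *
    \sum_(t : 'S_m) word_sum G
       [seq (fun x => chi w s i x * z x ^ k (t i)) | i <- enum 'I_m] (X :\ w)).
  under [RHS]eq_bigr do rewrite mulr_sumr.
  rewrite [RHS]exchange_big; apply: eq_bigr => s _ /=.
  under [RHS]eq_bigr do rewrite mulrCA.
  rewrite -mulr_sumr; congr (_ * _).
  under [RHS]eq_bigr do rewrite mulr_sumr.
  rewrite [RHS]exchange_big; apply: eq_bigr => t _ /=.
  rewrite word_sum_pull; apply: eq_bigr => w wX; congr (_ * _).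
  rewrite -[in RHS](filter_enum_ord_split m s) map_cat -!map_comp.
  congr (word_sum _ (_ ++ _) _); apply/eq_in_map => i; rewrite mem_filter => /andP[his _];
    apply/funext => x; rewrite /chi /= ?his 1?ltnNge ?his /= /letter /=;
    by case: eqP => _; rewrite ?mul0r // expr0z mul1r mulrC.
rewrite big1 // => w wX; rewrite /letter /=; case: eqP => [cw|_]; last by rewrite mul0r.
(* [P] is obtained before [chi], hence is the same for every [s] and factors out of the alternating
   sum, leaving exponents 0. *)
have [P hP] := word_sum_sym G (fun i x => z x ^ k i) (X :\ w).
rewrite (eq_bigr (fun s : 'I_m.+1 => P * (emb ((-1) ^+ s * qbinom (q ^+ d a) m s)
   * word_sum G [seq chi w s i | i <- enum 'I_m] (X :\ w)))) => [|s _].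
  by rewrite -mulr_sumr letter_serre_lin ?mulr0 // !inE eqxx.
by rewrite (hP (chi w s)) mulrCA.
Qed.

End Relations.

(** * Linear extension to the free algebra *)

Section AlgSum.
Variables (F K : fieldType) (emb : {rmorphism F -> K}) (I : choiceType).
Variables (T : finType) (G : T -> T -> K) (wt : I -> T -> K).
Local Notation free_alg := (malg (fmonom I) F).
Implicit Types (u v : free_alg) (X : {set T}) (m : fmonom I).

Definition alg_sum u X : K :=
  monalg.mmap emb (fun m => word_sum G (map wt m) X) u.

Lemma alg_sumD u v X : alg_sum (u + v) X = alg_sum u X + alg_sum v X.
Proof. exact: raddfD. Qed.

Lemma alg_sumB u v X : alg_sum (u - v) X = alg_sum u X - alg_sum v X.
Proof. exact: raddfB. Qed.

Lemma alg_sum0 X : alg_sum 0 X = 0.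
Proof. exact: raddf0. Qed.

Lemma alg_sum_sum (J : Type) (s : seq J) (P : pred J) (f : J -> free_alg) X :
  alg_sum (\sum_(j <- s | P j) f j) X = \sum_(j <- s | P j) alg_sum (f j) X.
Proof. exact: raddf_sum. Qed.

Lemma alg_sumU c m X : alg_sum (mkmalgU m c) X = emb c * word_sum G (map wt m) X.
Proof. exact: monalg.mmapU. Qed.

Lemma alg_sumE u X :
  alg_sum u X = \sum_(m <- finmap.enum_fset (msupp u)) emb (mcoeff m u) * word_sum G (map wt m) X.
Proof. by []. Qed.

Lemma alg_sumZ c u X : alg_sum (c *: u) X = emb c * alg_sum u X.
Proof.
rewrite malgZ_def /fgscale alg_sum_sum alg_sumE mulr_sumr.
by apply: eq_bigr => m _; rewrite alg_sumU rmorphM mulrA.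
Qed.

Lemma alg_sum_eq0 u X :
  (forall m, m \in finmap.enum_fset (msupp u) -> word_sum G (map wt m) X = 0) -> alg_sum u X = 0.
Proof.
by move=> h; rewrite alg_sumE big1_seq // => m /andP[_ mu]; rewrite h ?mulr0.
Qed.

Lemma alg_sum1 X : alg_sum 1 X = (X == set0)%:R.
Proof. by rewrite -[1]/(mkmalgU mone 1) alg_sumU rmorph1 mul1r fm1. Qed.

Lemma alg_sumM u v X : alg_sum (u * v) X = \sum_(S : {set T} | S \subset X)
    (\prod_(x in S) \prod_(y in X :\: S) G x y) * alg_sum u S * alg_sum v (X :\: S).
Proof.
rewrite malgME alg_sum_sum.
under [RHS]eq_bigr do rewrite (alg_sumE u) mulr_sumr mulr_suml.
rewrite [RHS]exchange_big; apply: eq_bigr => m1 _ /=.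
under [RHS]eq_bigr do rewrite (alg_sumE v) mulr_sumr.
rewrite alg_sum_sum [RHS]exchange_big; apply: eq_bigr => m2 _ /=.
rewrite alg_sumU fmM map_cat word_sum_cat mulr_sumr; apply: eq_bigr => S _.
by rewrite rmorphM; ring.
Qed.

Lemma mkmalgU1M m m' : mkmalgU m 1 * mkmalgU m' 1 = mkmalgU (mmul m m') 1 :> free_alg.
Proof. by rewrite malgM_def fgmulUU mulr1. Qed.

End AlgSum.

Section KillRelations.
Variables (F K : fieldType) (emb : {rmorphism F -> K}).
Variables (r : nat) (A : 'M[int]_r) (d : 'I_r -> nat) (q : F).
Hypothesis q0 : q != 0.
Hypothesis Adiag : forall i, A i i = 2.
Hypothesis Aoff : forall i j, i != j -> (A i j <= 0)%R.
Hypothesis Asym : forall i j, (d i)%:Z * A i j = (d j)%:Z * A j i.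
Hypothesis two_neq0 : 2 != 0 :> K.
Variables (N : nat) (c : 'I_N -> 'I_r) (z : 'I_N -> K).
Hypothesis z0 : forall x, z x != 0.
Let kap a b := emb (q ^ Defs.form A d a b).
Let G := kern c kap 1 z.

Lemma prod_free_gen (I : Type) (s : seq I) (P : pred I) a (k : I -> int) :
  \prod_(i <- s | P i) free_gen F a (k i)
    = mkmalgU (FMonom [seq (a, k i) | i <- s & P i]) 1 :> malg (fmonom ('I_r * int)%type) F.
Proof.
elim: s => [|i s IH].
  by rewrite big_nil /= -fmoneE.
rewrite big_cons; case: ifP => Pi /=; rewrite Pi //= IH /free_gen mkmalgU1M.
by congr (mkmalgU _ 1); apply/eqP; rewrite fmP fmM fmuE.
Qed.

Local Notation free_alg := (malg (fmonom ('I_r * int)%type) F).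

Let S : free_alg -> {set 'I_N} -> K := alg_sum emb G (letter c z).

Let S_lin k (u1 u2 u3 u4 : free_alg) X : S ((k *: u1 - u2) - (u3 - k *: u4)) X
      = (emb k * S u1 X - S u2 X) - (S u3 X - emb k * S u4 X).
Proof. by rewrite /S alg_sumB alg_sumB alg_sumB alg_sumZ alg_sumZ. Qed.

Let S_gen2 a k b l X : S (free_gen F a k * free_gen F b l) X
   = word_sum G [:: letter c z (a, k); letter c z (b, l)] X.
Proof. by rewrite /S /free_gen mkmalgU1M alg_sumU rmorph1 mul1r fmM !fmU. Qed.

Let S_quad a b k l X : S (quad_rel A d q a b k l) X = 0.
Proof.
rewrite /quad_rel; have quad := letter_quad emb q Asym c z0 a b k l (fun X => (X == set0)%:R) X.
move: (S) (@free_gen F r) S_lin S_gen2 => S' g lin gen.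
transitivity ((emb (q ^ Defs.form A d a b) * S' (g a (k + 1) * g b l) X
  - S' (g a k * g b (l + 1)) X) - (S' (g b l * g a (k + 1)) X
  - emb (q ^ Defs.form A d a b) * S' (g b (l + 1) * g a k) X)).
  exact: lin.
have comb (k0 s1 s2 s3 s4 w1 w2 w3 w4 : K) : s1 = w1 -> s2 = w2 -> s3 = w3 -> s4 = w4 ->
  k0 * w1 - w2 = w3 - k0 * w4 -> (k0 * s1 - s2) - (s3 - k0 * s4) = 0.
  by move=> -> -> -> -> ->; rewrite subrr.
exact: (comb _ _ _ _ _ _ _ _ _ (gen a (k + 1) b l X) (gen a k b (l + 1) X)
  (gen b l a (k + 1) X) (gen b (l + 1) a k X) quad).
Qed.

(** All [X] are treated at once because, by [alg_sumM], a product evaluates its middle factor on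
    subsets of [X]. *)
Lemma alg_sum_rel_ideal u : rel_ideal A d q u ->
  forall X, alg_sum emb G (letter c z) u X = 0.
Proof.
elim=> {u} [a b k l|a b k l ab||u v _ hu _ hv|u v w _ hv] X.
- exact: S_quad.
- rewrite /serre_rel alg_sum_sum.
  have := letter_serre emb q0 Adiag Aoff Asym two_neq0 c z0 k l X ab.
  rewrite -/kap -/G => e; rewrite -[RHS]e; apply: eq_bigr => s _.
  rewrite alg_sumZ alg_sum_sum; congr (_ * _); apply: eq_bigr => t _.
  rewrite !prod_free_gen /free_gen !mkmalgU1M alg_sumU rmorph1 mul1r.
  rewrite !fmM fmU !map_cat /= -!map_comp -!catA /=.
  by rewrite /index_enum -!enumT.
- exact: alg_sum0.
- by rewrite alg_sumB hu hv subrr.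
rewrite alg_sumM; apply: big1 => U _; rewrite [X in _ * X * _]alg_sumM.
rewrite [X in _ * X * _]big1 ?mulr0 ?mul0r // => U1 _.
by rewrite hv mulr0.
Qed.

End KillRelations.

(** * Products over pairs and signatures *)

Section PairProducts.
Variables (K : comNzRingType) (N : nat).
Implicit Types (t : 'I_N -> 'I_N -> K) (X S : {set 'I_N}).

Definition pair_prod t X : K := \prod_(x in X) \prod_(y in X | (x < y)%N) t x y.

Lemma pair_prod_split t X S : S \subset X ->
  pair_prod t X = pair_prod t S * pair_prod t (X :\: S)
    * \prod_(x in S) \prod_(y in X :\: S) (if (x < y)%N then t x y else t y x).
Proof.
move=> SX; have IS : X :&: S = S by apply/setIidPr.
have inner (x : 'I_N) : \prod_(y in X | (x < y)%N) t x y =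
    \prod_(y in S | (x < y)%N) t x y * \prod_(y in X :\: S | (x < y)%N) t x y.
  by rewrite !big_mkcondr (big_setID S) IS.
have cross : \prod_(x in S) \prod_(y in X :\: S) (if (x < y)%N then t x y else t y x)
   = \prod_(x in S) \prod_(y in X :\: S | (x < y)%N) t x y
     * \prod_(x in X :\: S) \prod_(y in S | (x < y)%N) t x y.
  have -> : \prod_(x in X :\: S) \prod_(y in S | (x < y)%N) t x y
      = \prod_(y in S) \prod_(x in X :\: S | (x < y)%N) t x y.
    under eq_bigr do rewrite big_mkcondr; rewrite exchange_big /=.
    by apply: eq_bigr => y _; rewrite big_mkcondr.
  rewrite -big_split; apply: eq_bigr => x xS /=; rewrite !big_mkcondr -big_split.
  apply: eq_bigr => y; rewrite inE => /andP[yS _] /=.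
  have xy : x != y by apply: contraNneq yS => <-.
  case: ltngtP => [_|_|/val_inj e]; rewrite ?mulr1 ?mul1r //.
  by rewrite e eqxx in xy.
rewrite /pair_prod (big_setID S) IS /= !(eq_bigr _ (fun x _ => inner x)) !big_split /=.
by rewrite cross; ring.
Qed.

Lemma pair_prod1 t x : pair_prod t [set x] = 1.
Proof.
rewrite /pair_prod big_set1 big1 // => y.
by rewrite inE => /andP[/eqP ->]; rewrite ltnn.
Qed.

Lemma pair_prod_setD1 t X x0 : x0 \in X ->
  pair_prod t X = (\prod_(y in X :\ x0) (if (x0 < y)%N then t x0 y else t y x0))
                  * pair_prod t (X :\ x0).
Proof.
move=> xX; rewrite (@pair_prod_split _ _ [set x0]) ?sub1set // big_set1.
by rewrite pair_prod1 mul1r mulrC.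
Qed.

Lemma eq_pair_prod t t' X :
  (forall x y, x \in X -> y \in X -> (x < y)%N -> t x y = t' x y) ->
  pair_prod t X = pair_prod t' X.
Proof.
by move=> e; apply: eq_bigr => x xX; apply: eq_bigr => y /andP[yX xy]; apply: e.
Qed.

Lemma pair_prodM t t' X :
  pair_prod (fun x y => t x y * t' x y) X = pair_prod t X * pair_prod t' X.
Proof. by rewrite -big_split; apply: eq_bigr => x _; rewrite -big_split. Qed.

Lemma pair_prodT t : pair_prod t setT = \prod_(i < N) \prod_(j < N | (i < j)%N) t i j.
Proof. by apply: eq_big => [i|i _]; [rewrite inE | apply: eq_bigl => j; rewrite inE]. Qed.

End PairProducts.

Lemma rmorph_pair_prod (K K' : comNzRingType) (f : {rmorphism K -> K'}) N
    (t : 'I_N -> 'I_N -> K) X :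
  f (pair_prod t X) = pair_prod (fun x y => f (t x y)) X.
Proof. by rewrite rmorph_prod; apply: eq_bigr => x _; rewrite rmorph_prod. Qed.

Lemma homo_ltn_inj N p (h : 'I_N -> 'I_p) : {homo h : x y / (x < y)%N} -> injective h.
Proof.
by move=> hm x y e; case: (ltngtP x y) => [/hm|/hm|/val_inj //]; rewrite e ltnn.
Qed.

Lemma pair_prod_imset (K : comNzRingType) N p (t : 'I_p -> 'I_p -> K)
    (h : 'I_N -> 'I_p) (X : {set 'I_N}) : {homo h : x y / (x < y)%N} ->
  pair_prod t (h @: X) = pair_prod (fun x y => t (h x) (h y)) X.
Proof.
move=> hm; have hmE x y : (h x < h y)%N = (x < y)%N.
  apply/idP/idP => [|/hm //]; rewrite ltnNge; apply: contraTT; rewrite -leqNgt.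
  by rewrite leq_eqVlt => /orP[/eqP/val_inj ->|/hm /ltnW ->] //; rewrite negbK.
have hi := homo_ltn_inj hm.
rewrite /pair_prod big_imset /=; last by move=> x y _ _ /hi.
apply: eq_bigr => x _; rewrite !big_mkcondr big_imset /=; last by move=> ? ? _ _ /hi.
by apply: eq_bigr => y _; rewrite hmE.
Qed.

(** * Signatures as products over pairs *)

Section Signs.
Variables (N : nat).
Implicit Types s : 'S_N.

Lemma pair_prod_perm (K : comNzRingType) (t : 'I_N -> 'I_N -> K) s :
  (forall x y, t x y = t y x) ->
  pair_prod (fun x y => t (s x) (s y)) setT = pair_prod t setT.
Proof.
move=> tC; rewrite /pair_prod.
have e (t' : 'I_N -> 'I_N -> K) :
    \prod_(x in [set: 'I_N]) \prod_(y in [set: 'I_N] | (x < y)%N) t' x y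
   = \prod_(p : 'I_N * 'I_N | (p.1 < p.2)%N) t' p.1 p.2.
  by rewrite pair_big_dep; apply: eq_bigl => p; rewrite !inE.
rewrite !e.
(* The action of [s] on unordered pairs, each represented by its increasing form. *)
pose f (s : 'S_N) (p : 'I_N * 'I_N) := if (s p.1 < s p.2)%N then (s p.1, s p.2) else (s p.2, s p.1).
rewrite [RHS](reindex_onto (f s) (f s^-1%g)) /=; last first.
  move=> [x y] /= xy; rewrite /f /=.
  case: (ltnP (s^-1%g x) (s^-1%g y)) => _ /=; rewrite !permKV ?xy //.
  by rewrite ltnNge ltnW.
apply: eq_big => [[x y]|[x y] /= xy]; rewrite /f /=; last by case: ltnP.
have sxy : x != y -> s x != s y by rewrite (inj_eq perm_inj).
have swap (u v : 'I_N) : (u < v)%N -> ((v, u) == (u, v)) = false.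
  by move=> uv; apply/eqP => -[e1 _]; rewrite e1 ltnn in uv.
case: (ltnP (s x) (s y)) => h /=; rewrite !permK.
  rewrite h /=; case: (ltngtP x y) => [_|/swap|/val_inj e1]; rewrite ?eqxx //.
    by rewrite eq_sym => ->.
  by rewrite e1 ltnn in h.
case: (ltngtP x y) => [xy|/swap|/val_inj ->]; rewrite ?eqxx ?ltnn //.
  rewrite andbT ltn_neqAle h andbT (inj_eq val_inj) eq_sym sxy //.
  by rewrite -(inj_eq val_inj) neq_ltn xy.
by rewrite eq_sym => ->; rewrite andbF.
Qed.

(** Permuting the columns of the Vandermonde matrix of 0, ..., N - 1 multiplies its positive
    determinant by the signature; comparing signs of the factors counts the inversions. *)
Lemma pair_prod_sign_int s :
  pair_prod (fun x y => (-1) ^+ (s y < s x)%N) setT = (-1) ^+ odd_perm s :> int.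
Proof.
pose a : 'rV[int]_N := \row_i (i : nat)%:Z.
have V0 : 0 < pair_prod (fun x y : 'I_N => (y : nat)%:Z - (x : nat)%:Z) setT.
  by rewrite pair_prodT prodr_gt0 // => i _; rewrite prodr_gt0 // => j ij; rewrite subr_gt0.
have eV (b : 'rV[int]_N) : pair_prod (fun x y => b 0 y - b 0 x) setT = \det (Vandermonde N b).
  by rewrite pair_prodT det_Vandermonde.
have e : pair_prod (fun x y => (s y : nat)%:Z - (s x : nat)%:Z) setT
   = (-1) ^+ odd_perm s * pair_prod (fun x y : 'I_N => (y : nat)%:Z - (x : nat)%:Z) setT.
  transitivity (pair_prod (fun x y => (col_perm s a) 0 y - (col_perm s a) 0 x) setT).
    by apply: eq_pair_prod => x y _ _ _; rewrite !mxE.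
  have -> : pair_prod (fun x y : 'I_N => (y : nat)%:Z - (x : nat)%:Z) setT
     = pair_prod (fun x y => a 0 y - a 0 x) setT.
    by apply: eq_pair_prod => x y _ _ _; rewrite !mxE.
  rewrite !eV; have -> : Vandermonde N (col_perm s a) = col_perm s (Vandermonde N a).
    by apply/matrixP => i j; rewrite !mxE.
  by rewrite col_permE det_mulmx det_perm odd_permV mulrC.
have sgP (t : 'I_N -> 'I_N -> int) :
    Num.sg (pair_prod t setT) = pair_prod (fun x y => Num.sg (t x y)) setT.
  have sg1 : Num.sg (1 : int) = 1 by [].
  rewrite !pair_prodT (big_morph _ (@sgrM _) sg1); apply: eq_bigr => x _.
  by rewrite (big_morph _ (@sgrM _) sg1).
have := congr1 Num.sg e; rewrite sgrM [Num.sg (pair_prod _ _) in RHS]gtr0_sg // mulr1.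
rewrite sgP => e2; rewrite -[RHS](_ : Num.sg ((-1) ^+ odd_perm s) = _); last by case: (odd_perm s).
rewrite -e2; apply: eq_pair_prod => x y _ _ xy.
have sxy : s x != s y by rewrite (inj_eq perm_inj) -(inj_eq val_inj) neq_ltn xy.
case: ltngtP => h /=.
- by rewrite ltr0_sg // subr_lt0.
- by rewrite gtr0_sg // subr_gt0.
by move/val_inj: h sxy => ->; rewrite eqxx.
Qed.

Lemma pair_prod_sign (K : comNzRingType) s :
  pair_prod (fun x y => (-1) ^+ (s y < s x)%N) setT = (-1) ^+ odd_perm s :> K.
Proof.
have := congr1 (intr : int -> K) (pair_prod_sign_int s).
rewrite rmorphXn rmorphN1 => <-; rewrite /pair_prod rmorph_prod.
apply: eq_bigr => x _; rewrite rmorph_prod; apply: eq_bigr => y _.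
by rewrite rmorphXn rmorphN1.
Qed.

Lemma pair_prod_alt (K : comNzRingType) (t : 'I_N -> 'I_N -> K) s :
  (forall x y, x != y -> t y x = - t x y) ->
  pair_prod (fun x y => t (s x) (s y)) setT = (-1) ^+ odd_perm s * pair_prod t setT.
Proof.
(* [t'] is the symmetric function that agrees with [t] on increasing pairs, so that [pair_prod_perm]
   applies and only the inversion signs remain. *)
move=> tA; pose t' (x y : 'I_N) := if (x < y)%N then t x y else if (y < x)%N then t y x else 1.
have -> : pair_prod t setT = pair_prod t' setT.
  by apply: eq_pair_prod => x y _ _ xy; rewrite /t' xy.
rewrite -pair_prod_sign -(pair_prod_perm s (t := t')) -?pair_prodM; last first.
  by move=> x y; rewrite /t'; case: ltngtP.
apply: eq_pair_prod => x y _ _ xy; rewrite /t'.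
have sxy : s x != s y by rewrite (inj_eq perm_inj) -(inj_eq val_inj) neq_ltn xy.
case: ltngtP => h /=; rewrite ?expr0 ?expr1 ?mul1r //.
  by rewrite tA ?mulN1r // eq_sym.
by move/val_inj: h sxy => ->; rewrite eqxx.
Qed.

End Signs.

(** Renaming affects only the signs in [kern]: each pair inverted by [h] contributes one sign,
    whichever of its variables is enumerated first. *)
Lemma word_sum_imset (K : comNzRingType) (r N p : nat) (h : 'I_N -> 'I_p)
    (c : 'I_p -> 'I_r) (kap : 'I_r -> 'I_r -> K) (e : K) (z : 'I_p -> K)
    (u : seq ('I_p -> K)) (X : {set 'I_N}) : injective h ->
  word_sum (kern c kap e z) u (h @: X)
    = pair_prod (fun x y => (-1) ^+ (h y < h x)%N) X
      * word_sum (kern (c \o h) kap e (z \o h)) [seq ph \o h | ph <- u] X.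
Proof.
move=> hi; elim: u X => [|ph u IH] X /=.
  rewrite imset_eq0; case: eqP => [->|_]; last by rewrite mulr0.
  by rewrite /pair_prod big_set0 mulr1.
rewrite /letter_op big_imset /=; last by move=> x y _ _ /hi.
rewrite mulr_sumr; apply: eq_bigr => x xX.
have -> : h @: X :\ h x = h @: (X :\ x).
  apply/setP => y; apply/setD1P/imsetP.
    case=> yx /imsetP[w wX ew]; exists w; rewrite // !inE wX andbT.
    by apply: contraNneq yx => <-; rewrite ew.
  case=> w; rewrite !inE => /andP[wx wX] ->.
  by rewrite (inj_eq hi) imset_f.
rewrite IH big_imset /=; last by move=> ? ? _ _ /hi.
rewrite (pair_prod_setD1 _ xX).
have -> : \prod_(y in X :\ x) kern c kap e z (h x) (h y)
   = \prod_(y in X :\ x) (if (x < y)%N then (-1) ^+ (h y < h x)%N else (-1) ^+ (h x < h y)%N)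
     * \prod_(y in X :\ x) kern (c \o h) kap e (z \o h) x y.
  rewrite -big_split; apply: eq_bigr => y; rewrite !inE => /andP[yx _] /=.
  have hyx : h y != h x by rewrite (inj_eq hi).
  rewrite /kern /= mulrA; congr (_ * _); case: (ltngtP x y) => [_|_|/val_inj exy].
  - by rewrite expr0 mulr1.
  - rewrite expr1; case: (ltngtP (h x) (h y)) => [_|_|/val_inj exy];
      rewrite ?mulrNN ?mulr1 ?mulrN1 //.
    by rewrite exy eqxx in hyx.
  - by rewrite exy eqxx in yx.
ring.
Qed.

Lemma word_sum_mono (K : comNzRingType) (r N p : nat) (h : 'I_N -> 'I_p)
    (c : 'I_p -> 'I_r) (kap : 'I_r -> 'I_r -> K) (e : K) (z : 'I_p -> K)
    (u : seq ('I_p -> K)) (X : {set 'I_N}) : {homo h : x y / (x < y)%N} ->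
  word_sum (kern c kap e z) u (h @: X)
    = word_sum (kern (c \o h) kap e (z \o h)) [seq ph \o h | ph <- u] X.
Proof.
move=> hm; rewrite word_sum_imset; last exact: homo_ltn_inj hm.
rewrite /pair_prod big1 ?mul1r // => x _; rewrite big1 // => y /andP[_ /hm xy].
by rewrite ltnNge ltnW.
Qed.

Lemma word_sum_perm (K : comNzRingType) (r N : nat) (s : 'S_N)
    (c : 'I_N -> 'I_r) (kap : 'I_r -> 'I_r -> K) (e : K) (z : 'I_N -> K)
    (u : seq ('I_N -> K)) : (forall x, c (s x) = c x) ->
  word_sum (kern c kap e (z \o s)) [seq ph \o s | ph <- u] setT
    = (-1) ^+ odd_perm s * word_sum (kern c kap e z) u setT.
Proof.
move=> cs; have -> : kern c kap e (z \o s) = kern (c \o s) kap e (z \o s).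
  by apply/funext => x; apply/funext => y; rewrite /kern /= !cs.
have sT : [set: 'I_N] = s @: setT.
  by apply/esym/setP => y; rewrite inE -[y](permKV s) imset_f.
rewrite [in RHS]sT word_sum_imset; last exact: perm_inj.
by rewrite pair_prod_sign mulrA -expr2 sqrr_sign mul1r.
Qed.

(** * Divisibility by the Vandermonde and the wheel conditions *)

Section VandermondeDivision.
Variables (R : idomainType) (N : nat).
Implicit Types (P Q : {mpoly R[N]}) (i j k l : 'I_N).

Definition diag_subst i j (P : {mpoly R[N]}) : {mpoly R[N]} :=
  P \mPo [tuple 'X_(if k == i then j else k) | k < N].

Lemma diag_substX i j k : diag_subst i j 'X_k = 'X_(if k == i then j else k).
Proof. by rewrite /diag_subst comp_mpolyXU -tnth_nth tnth_mktuple. Qed.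

Lemma mpolyXU_neq i j : i != j -> 'X_i - 'X_j != 0 :> {mpoly R[N]}.
Proof.
move=> ij; apply/eqP => /(congr1 (meval (fun k => (k == i)%:R))).
rewrite mevalB !mevalXU meval0 eqxx eq_sym (negbTE ij) subr0.
by move/eqP; rewrite oner_eq0.
Qed.

Lemma diag_subst_mod i j P : exists Q, P - diag_subst i j P = ('X_i - 'X_j) * Q.
Proof.
(* This congruence is compatible with products, so it suffices to check it on single variables. *)
pose D a b := exists Q, a - b = ('X_i - 'X_j) * Q :> {mpoly R[N]}.
have DM a b a' b' : D a b -> D a' b' -> D (a * a') (b * b').
  move=> [Q e] [Q' e']; exists (a * Q' + Q * b').
  by rewrite mulrDr [_ * (a * Q')]mulrCA -e' mulrA -e; ring.
elim/mpolyind: P => [|c m p _ _ [Q eQ]].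
  by exists 0; rewrite /diag_subst comp_mpoly0 subrr mulr0.
have [Q' eQ'] : D 'X_[m] (diag_subst i j 'X_[m]).
  rewrite /diag_subst comp_mpolyX mpolyXE_id.
  elim/big_ind2: _ => [|a b a' b'|k _]; [by exists 0; rewrite subrr mulr0 | exact: DM |].
  rewrite tnth_mktuple; elim: (m k) => [|n IH]; first by exists 0; rewrite subrr mulr0.
  rewrite !exprS; apply: DM IH.
  by case: eqP => [->|_]; [exists 1; rewrite mulr1 | exists 0; rewrite subrr mulr0].
exists (c *: Q' + Q); rewrite /diag_subst comp_mpolyD comp_mpolyZ -!/(diag_subst i j _).
by rewrite opprD addrACA -scalerBr eQ eQ' mulrDr scalerAr.
Qed.

Lemma diag_subst_div i j P : diag_subst i j P = 0 -> exists Q, P = ('X_i - 'X_j) * Q.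
Proof. by have [Q] := diag_subst_mod i j P => + e; rewrite e subr0; exists Q. Qed.

(** One factor is removed at a time. The quotient still vanishes on the other diagonals, because
    ['X_i - 'X_j] does not vanish identically on the diagonal of a different increasing pair. *)
Lemma vandermonde_div (s : seq ('I_N * 'I_N)) P :
  uniq s -> (forall p, p \in s -> (p.1 < p.2)%N) ->
  (forall p, p \in s -> diag_subst p.1 p.2 P = 0) ->
  exists Q, P = (\prod_(p <- s) ('X_p.1 - 'X_p.2)) * Q.
Proof.
elim: s P => [|[i j] s IH] P; first by exists P; rewrite big_nil mul1r.
move=> /= /andP[ijs us] lts zs.
have ij : (i < j)%N by apply: (lts (i, j)); rewrite mem_head.
have [Q eQ] : exists Q, P = ('X_i - 'X_j) * Q.
  by apply: diag_subst_div; apply: (zs (i, j)); rewrite mem_head.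
case: (IH Q us) => [p ps|[k l] ps|Q' eQ'].
- by apply: lts; rewrite inE ps orbT.
- have kl : (k < l)%N by apply: (lts (k, l)); rewrite inE ps orbT.
  have /eqP : diag_subst k l P = 0 by apply: (zs (k, l)); rewrite inE ps orbT.
  rewrite eQ /diag_subst rmorphM rmorphB /= -!/(diag_subst k l _) !diag_substX.
  rewrite mulf_eq0 => /orP[|/eqP //]; apply: contraTeq => _; apply: mpolyXU_neq.
  case: (eqVneq i k) => [ik|ik].
    have -> : (j == k) = false by apply/eqP => jk; rewrite ik jk ltnn in ij.
    by apply: contraNneq ijs => <-; rewrite ik.
  case: (eqVneq j k) => [jk|jk].
    apply/eqP => il; have := ltn_trans ij (leq_ltn_trans (leqnn _) _).
    by rewrite jk il => /(_ _ kl); rewrite ltnn.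
  by apply/eqP => e; rewrite e ltnn in ij.
by exists Q'; rewrite big_cons /= eQ eQ' mulrA.
Qed.

End VandermondeDivision.

Section WheelVanish.
Variables (K : comNzRingType) (r N : nat) (c : 'I_N -> 'I_r).
Variables (kap : 'I_r -> 'I_r -> K) (e : K) (z : 'I_N -> K).

(* A nonzero term of the sum would enumerate the wheel in the cyclic order
   [j, t_(m-1), ..., t_0, j]. *)
Lemma word_sum_wheel (m : nat) (t : 'I_m -> 'I_N) (j : 'I_N) u (X : {set 'I_N}) :
  (0 < m)%N -> injective t -> (forall l, t l != j) ->
  (forall l l' : 'I_m, l' = l.+1 :> nat ->
     kap (c (t l)) (c (t l')) * z (t l') = e * z (t l)) ->
  (forall l : 'I_m, m = l.+1 -> kap (c (t l)) (c j) * z j = e * z (t l)) ->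
  (forall l : 'I_m, l = 0 :> nat -> kap (c j) (c (t l)) * z (t l) = e * z j) ->
  j \in X -> (forall l, t l \in X) -> word_sum (kern c kap e z) u X = 0.
Proof.
move=> m0 ti tj hl hmax h0; elim: u X => [|ph u IH] X jX tX /=.
  by case: eqP => // X0; rewrite X0 inE in jX.
have zero x y : y \in X -> y != x -> kap (c x) (c y) * z y = e * z x ->
    \prod_(w in X :\ x) kern c kap e z x w = 0.
  move=> yX yx h; apply/eqP; rewrite (big_setD1 y) /= ?inE ?yx //.
  by rewrite /kern h subrr mulr0 mul0r.
(* If the first letter takes a point [x] of the wheel, the next point of the cycle is still in [X]
   and kills the kernel product; otherwise the whole wheel remains in [X :\ x]. *)
apply: big1 => x xX.
case: (eqVneq x j) => [->|xj].
  by rewrite (zero j (t (Ordinal m0))) ?mulr0 ?mul0r //; apply: h0.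
case: (pickP (fun l => t l == x)) => [l /eqP tl|nt].
  rewrite -tl; have := ltn_ord l; rewrite leq_eqVlt => /orP[/eqP lm|lm].
    by rewrite (zero (t l) j) ?mulr0 ?mul0r // ?hmax // eq_sym.
  rewrite (zero (t l) (t (Ordinal lm))) ?mulr0 ?mul0r //; last exact: hl.
  by rewrite (inj_eq ti) -(inj_eq val_inj) /= gtn_eqF.
by rewrite IH ?mulr0 // => [|l]; rewrite !inE ?jX ?tX ?andbT ?nt // eq_sym.
Qed.

End WheelVanish.

(** * Renaming of variables as a field morphism *)

Section RenameMorphism.
Variables (F : fieldType) (r : nat).
Local Notation degree := {ffun 'I_r -> nat}.
Local Notation idx n := 'I_(\sum_a n a)%N.
Local Notation ratf n := {fraction {mpoly F[\sum_a n a]}}.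
Variables (n p : degree) (h : idx n -> idx p) (hinj : injective h).

(** The proof of injectivity is an argument so that the morphism structure, which depends on it, can
    be attached to the function. *)
Definition rename_inj of injective h := @rename F r n p h.
Local Notation ren := (rename_inj hinj).

Let renamep_neq0 (B : {mpoly F[_]}) : B != 0 -> renamep h B != 0.
Proof. by rewrite -(inj_eq (renamep_inj hinj)) {2}/renamep comp_mpoly0. Qed.

Let renE P Q : Q != 0 ->
  ren (tofrac P / tofrac Q) = tofrac (renamep h P) / tofrac (renamep h Q).
Proof. exact: renameE. Qed.

Let fracP (f : ratf n) : exists P Q, Q != 0 /\ f = tofrac P / tofrac Q.
Proof.
by exists \n_(repr f), \d_(repr f); split; [apply: denom_ratioP | apply: frac_numden].
Qed.

Lemma rename_tofrac P : ren (tofrac P) = tofrac (renamep h P).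
Proof.
rewrite -[tofrac P]divr1 -tofrac1 renE ?oner_eq0 //.
by rewrite /renamep rmorph1 tofrac1 divr1.
Qed.

Lemma rename_is_zmod_morphism : zmod_morphism ren.
Proof.
move=> f g; have [P [Q [Q0 ->]]] := fracP f; have [P' [Q' [Q0' ->]]] := fracP g.
have t0 (B : {mpoly F[\sum_a n a]}) : B != 0 -> tofrac B != 0 by rewrite tofrac_eq0.
have t1 (B : {mpoly F[\sum_a n a]}) : B != 0 -> tofrac (renamep h B) != 0.
  by move=> B0; rewrite tofrac_eq0 renamep_neq0.
rewrite -mulNr addf_div ?t0 // -tofracN -!tofracM -tofracD !renE ?mulf_neq0 //.
rewrite -mulNr addf_div ?t1 // /renamep rmorphD !rmorphM rmorphN /=.
by rewrite tofracD !tofracM tofracN.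
Qed.

Lemma rename_is_monoid_morphism : monoid_morphism ren.
Proof.
split; first by rewrite -tofrac1 rename_tofrac /renamep rmorph1.
move=> f g; have [P [Q [Q0 ->]]] := fracP f; have [P' [Q' [Q0' ->]]] := fracP g.
rewrite mulf_div -!tofracM !renE ?mulf_neq0 // /renamep !rmorphM /=.
by rewrite mulf_div.
Qed.

HB.instance Definition _ :=
  GRing.isZmodMorphism.Build _ _ ren rename_is_zmod_morphism.
HB.instance Definition _ :=
  GRing.isMonoidMorphism.Build _ _ ren rename_is_monoid_morphism.

Lemma rename_z i : ren (z F i) = z F (h i).
Proof.
by rewrite /z rename_tofrac /renamep comp_mpolyXU -tnth_nth tnth_mktuple.
Qed.

Lemma rename_cst c : ren (cst n c) = cst p c.
Proof. by rewrite /cst rename_tofrac /renamep comp_mpolyC. Qed.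

End RenameMorphism.

Lemma word_sum_scale (K : comNzRingType) (N : nat) (G : 'I_N -> 'I_N -> K) a u X :
  word_sum (fun x y => a * G x y) u X = pair_prod (fun _ _ => a) X * word_sum G u X.
Proof.
elim: u X => [|ph u IH] X /=.
  by case: eqP => [->|_]; rewrite ?mulr0 // /pair_prod big_set0 mulr1.
rewrite /letter_op mulr_sumr; apply: eq_bigr => x xX.
rewrite IH (pair_prod_setD1 _ xX) big_split /=.
by under [X in _ = X * _ * _]eq_bigr do rewrite if_same; ring.
Qed.

Lemma cancel_denom (K : fieldType) (x y v t : K) : x != 0 -> y != 0 ->
  v * t = x * y * (v * (x^-1 * t / y)).
Proof. by move=> x0 y0; field; rewrite x0 y0. Qed.

Lemma common_denom (R : comNzRingType) (K : fieldType) (f : {rmorphism R -> K})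
    (P P' X : R) k k' : f X != 0 ->
  f P / f X ^+ k + f P' / f X ^+ k' = f (P * X ^+ k' + P' * X ^+ k) / f X ^+ (k + k').
Proof.
move=> X0; rewrite addf_div ?expf_neq0 // rmorphD !rmorphM !rmorphXn exprD.
by congr (_ / _); ring.
Qed.

Section WordLaurent.
Variables (F : fieldType) (r : nat) (A : 'M[int]_r) (d : 'I_r -> nat) (q : F).
Hypothesis q0 : q != 0.
Hypothesis two_neq0 : 2 != 0 :> F.
Hypothesis Adiag : forall i, A i i = 2.
Hypothesis Aoff : forall i j, i != j -> (A i j <= 0)%R.
Hypothesis Asym : forall i j, (d i)%:Z * A i j = (d j)%:Z * A j i.
Hypothesis d_gt0 : forall i, (0 < d i)%N.
Variables (N : nat) (col : 'I_N -> 'I_r).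
Variables (ratf : fieldType) (tau : {rmorphism {mpoly F[N]} -> ratf}).
Let z i := tau 'X_i.
Let cst : {rmorphism F -> ratf} := tau \o @mpolyC N F.
Hypothesis z0 : forall i, z i != 0.

Definition shuffle_kern : 'I_N -> 'I_N -> ratf :=
  kern col (fun a b => cst (q ^ Defs.form A d a b)) 1 z.

Definition vandermonde : ratf :=
  \prod_(i : 'I_N) \prod_(j : 'I_N | (i < j)%N && (col i == col j)) (z i - z j).

Definition lfrac (P : {mpoly F[N]}) (k : nat) : ratf := tau P / (\prod_i z i) ^+ k.

Section OneWord.
Variable w : seq ('I_r * int).

(* [P0] is the numerator of the image of [w] with an indeterminate in place of
   q; shifting the q-exponents by E and the z-exponents by M makes them
   nonnegative. *)
Let E := (\sum_a \sum_b `|Defs.form A d a b|)%N.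
Let M := (\sum_(p <- w) `|p.2|)%N.

Let E_ge a b : 0 <= E%:Z + Defs.form A d a b.
Proof.
have : (`|Defs.form A d a b| <= E)%N.
  by rewrite /E (bigD1 a) //= (bigD1 b) //= -addnA leq_addr.
by lia.
Qed.

Let M_ge p : p \in w -> 0 <= p.2 + M%:Z.
Proof.
move=> pw; have : (`|p.2| <= M)%N.
  by rewrite /M (big_rem p) //= leq_addr.
by lia.
Qed.

(** Stated over any ring because the generic numerator, its restriction to a diagonal, its value at
    a point and its specialization at [q] are all instances, related by [wsum_morph]. *)
Let wsum (S : comNzRingType) (kp : 'I_r -> 'I_r -> S) (e : S) (x : 'I_N -> S) : S :=
  word_sum (kern col kp e x)
    [seq (fun i => if col i == p.1 then x i ^+ `|p.2 + M%:Z| else 0) | p <- w] setT.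

Let wsum_morph (S S' : comNzRingType) (f : {rmorphism S -> S'}) kp e x :
  f (wsum kp e x) = wsum (fun a b => f (kp a b)) (f e) (fun i => f (x i)).
Proof.
rewrite /wsum rmorph_word_sum -map_comp; congr (word_sum _ _ _).
  apply/funext => i; apply/funext => j; rewrite /kern rmorphM rmorphB !rmorphM.
  by rewrite rmorphXn rmorphN1.
apply/eq_in_map => p _; apply/funext => i /=.
by case: ifP => _; rewrite ?rmorph0 // rmorphXn.
Qed.

Let kX a b : {poly F} := 'X^(`|E%:Z + Defs.form A d a b|).
Let P0 : {mpoly {poly F}[N]} :=
  wsum (fun a b => (kX a b)%:MP) (('X^E)%:MP) (fun i => 'X_i).

(** On the diagonal the point is fixed by a color-preserving transposition, so antisymmetry makes
    the sum equal to its opposite. *)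
Let P0_diag i j : i != j -> col i = col j -> diag_subst i j P0 = 0.
Proof.
move=> ij cij.
have cs k : col (tperm i j k) = col k by case: tpermP => [->|->|].
have alt kp e (x : 'I_N -> {mpoly {poly F}[N]}) : x \o tperm i j = x -> wsum kp e x = 0.
  move=> xs; have := word_sum_perm kp e x
   [seq (fun i => if col i == p.1 then x i ^+ `|p.2 + M%:Z| else 0) | p <- w] cs.
  rewrite xs -map_comp odd_tperm ij expr1 mulN1r.
  have -> : [seq ((fun ph => ph \o tperm i j) \o
      (fun (p : 'I_r * int) (i0 : 'I_N) =>
         if col i0 == p.1 then x i0 ^+ `|p.2 + M%:Z| else 0)) i0 | i0 <- w]
     = [seq (fun i => if col i == p.1 then x i ^+ `|p.2 + M%:Z| else 0) | p <- w].
    apply/eq_in_map => p _; apply/funext => k /=; rewrite cs.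
    by rewrite -[x (tperm i j k)]/((x \o tperm i j) k) xs.
  rewrite -/(wsum kp e x) => /eqP; rewrite -addr_eq0 -mulr2n -mulr_natl mulf_eq0 => /orP[|/eqP //].
  rewrite -(rmorph_nat (@mpolyC _ _)) mpolyC_eq0 -(rmorph_nat (@polyC _)) polyC_eq0.
  by rewrite (negbTE two_neq0).
rewrite /diag_subst; set tt := [tuple _ | _ < _].
rewrite -[LHS]/(comp_mpoly tt P0) /P0 wsum_morph; apply: alt.
apply/funext => k; rewrite /= !comp_mpolyXU -!tnth_nth !tnth_mktuple.
by case: tpermP => [->|->|//]; rewrite ?eqxx // eq_sym; case: eqP.
Qed.

Let prs := [seq p : 'I_N * 'I_N <- enum {: 'I_N * 'I_N} | (p.1 < p.2)%N && (col p.1 == col p.2)].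

Let prs_prod (S : comNzRingType) (f : 'I_N -> 'I_N -> S) :
  \prod_(p <- prs) f p.1 p.2
    = \prod_(i : 'I_N) \prod_(j : 'I_N | (i < j)%N && (col i == col j)) f i j.
Proof.
by rewrite big_filter big_enum_cond /= pair_big_dep.
Qed.

Let P0_div : exists Q, P0 = (\prod_(p <- prs) ('X_(p.1) - 'X_(p.2))) * Q.
Proof.
apply: vandermonde_div => [|p|p].
- by rewrite filter_uniq // enum_uniq.
- by rewrite mem_filter => /andP[/andP[]].
rewrite mem_filter => /andP[/andP[lt /eqP c] _]; apply: P0_diag => //.
by rewrite -(inj_eq val_inj) neq_ltn lt.
Qed.

Let spec : {mpoly {poly F}[N]} -> ratf := tau \o map_mpoly (horner_eval q).

(** The exponent shifts contribute [q ^+ E] for each pair and a power [M] of each variable,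
    independently of the enumeration, hence come out as a common nonzero factor. *)
Let spec_P0 : exists2 a : F, a != 0 &
  spec P0 = cst a * (\prod_i z i) ^+ M
    * word_sum shuffle_kern [seq letter col z p | p <- w] setT.
Proof.
pose a := pair_prod (fun _ _ : 'I_N => q ^+ E) setT.
exists a.
  by rewrite /a pair_prodT; apply/prodf_neq0 => i _; apply/prodf_neq0 => j _; rewrite expf_neq0.
rewrite /spec /P0 wsum_morph /wsum.
transitivity (word_sum (fun x y => cst (q ^+ E) * shuffle_kern x y)
   [seq (fun i => ph i * z i ^+ M) | ph <- [seq letter col z p | p <- w]] setT).
  congr (word_sum _ _ _).
    apply/funext => i; apply/funext => j; rewrite /shuffle_kern /kern mulrCA; congr (_ * _).
    rewrite /= !map_mpolyC !map_mpolyX /= !/(horner_eval _ _) !hornerXn.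
    rewrite mulrBr mul1r mulrA -[cst _ * cst _]rmorphM; congr (tau _%:MP * _ - _ * _).
    rewrite !exprnP -expfzDr //; congr (q ^ _); have := E_ge (col i) (col j); lia.
  rewrite -map_comp; apply/eq_in_map => p pw; apply/funext => i /=; rewrite /letter map_mpolyX.
  case: eqP => _; rewrite ?mul0r //.
  by rewrite !exprnP -expfzDr // (gez0_abs (M_ge pw)).
rewrite [LHS]word_sum_scale [X in _ * X = _]word_sum_mul mulrA; congr (_ * _ * _).
  by rewrite /a /pair_prod rmorph_prod; apply: eq_bigr => i _; rewrite rmorph_prod.
by rewrite -prodrXl; apply: eq_bigl => i; rewrite inE.
Qed.

Definition on_wheel_pt (a b : 'I_r) (t : 'I_(serre_len A a b) -> 'I_N) (j : 'I_N)
    (v : 'I_N -> F) : Prop :=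
  forall l : 'I_(serre_len A a b),
    (q ^+ d a) ^+ (2 * l) * v (t l) = (q ^+ d a) ^ (- A a b) * v j.

Definition wheel_zero (P : {mpoly F[N]}) : Prop :=
  forall (a b : 'I_r) (t : 'I_(serre_len A a b) -> 'I_N) (j : 'I_N) (v : 'I_N -> F),
    a != b -> col j = b -> injective t -> (forall l, col (t l) = a) ->
    (forall i, v i != 0) -> on_wheel_pt t j v -> P.@[v] = 0.

(** At a point with distinct coordinates in each color, the Vandermonde is a nonzero element of the
    domain [{poly F}] and can be cancelled. *)
Let P0_point (x : 'I_N -> {poly F}) Q : P0 = (\prod_(p <- prs) ('X_(p.1) - 'X_(p.2))) * Q ->
  (forall i j, i != j -> col i = col j -> x i != x j) -> wsum kX 'X^E x = 0 -> Q.@[x] = 0.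
Proof.
move=> eQ xd; have := congr1 (meval x) eQ; rewrite mevalM {1}/P0 wsum_morph /=.
have -> : wsum (fun a b => ((kX a b)%:MP).@[x]) ('X^E%:MP).@[x] (fun i => ('X_i).@[x])
   = wsum kX 'X^E x.
  rewrite mevalC; congr wsum; apply/funext => a; last by rewrite mevalXU.
  by apply/funext => b; rewrite mevalC.
move=> -> /eqP; rewrite mulf_eq0 => /orP[|/eqP //].
rewrite rmorph_prod /= prodf_seq_eq0 => /hasP[p].
rewrite mem_filter => /andP[/andP[lt /eqP cp] _] /=.
rewrite mevalB !mevalXU subr_eq0.
have pne : p.1 != p.2 by rewrite -(inj_eq val_inj) neq_ltn lt.
by rewrite (negbTE (xd _ _ pne cp)).
Qed.

Let meval_spec (Q : {mpoly {poly F}[N]}) (x : 'I_N -> {poly F}) (v : 'I_N -> F) :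
  (forall i, (x i).[q] = v i) -> (map_mpoly (horner_eval q) Q).@[v] = (Q.@[x]).[q].
Proof.
move=> xv; elim/mpolyind: Q => [|c m p _ _ IH]; first by rewrite raddf0 !meval0 horner0.
rewrite rmorphD /= map_mpolyZ map_mpolyX !mevalD !mevalZ !mevalX hornerD hornerM IH.
congr (_ * _ + _); rewrite -/(horner_eval q _) rmorph_prod; apply: eq_bigr => i _.
by rewrite rmorphXn /= /horner_eval xv.
Qed.

(* The point v is lifted to a generic point of the wheel over F['X], where 'X
   specialises to q; a general lift separates the coordinates of equal color,
   which is needed since q may be a root of unity. *)
Let wheel_lift (a b : 'I_r) (t : 'I_(serre_len A a b) -> 'I_N) (j : 'I_N) (v : 'I_N -> F) :
  a != b -> col j = b -> injective t -> (forall l, col (t l) = a) ->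
  (forall i, v i != 0) -> on_wheel_pt t j v ->
  exists x : 'I_N -> {poly F}, [/\ forall i, (x i).[q] = v i,
    forall i k, i != k -> col i = col k -> x i != x k & wsum kX 'X^E x = 0].
Proof.
move=> ab cj ti ct v0 hw; set m := serre_len A a b in t ti ct hw *.
have mE : - A a b = (m.-1)%:Z by rewrite /m /serre_len; have := Aoff ab; lia.
have m0 : (0 < m)%N by rewrite /m /serre_len; have := Aoff ab; lia.
(* Chosen so that [cc *: 'X^(d a * m.-1)] takes the value [v j] at [q]; the equations of the wheel
   then force the values of the other wheel coordinates. *)
pose cc := v j / q ^+ (d a * m.-1).
have cc0 : cc != 0 by rewrite mulf_neq0 ?invr_eq0 ?expf_neq0.
(* Larger than the degrees of all wheel coordinates. Off the wheel, the correction in [x] vanishes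
   at [q] and gives coordinate [i] the degree [D + i + 1]. *)
pose D := (2 * d a * m).+1.
pose x i : {poly F} := if i == j then cc *: 'X^(d a * m.-1)
  else if [pick l | t l == i] is Some l then cc *: 'X^(2 * d a * (m.-1 - l))
  else (v i)%:P + ('X - q%:P) * 'X^(D + i).
have tj l : t l != j by apply: contraNneq ab => e; rewrite -(ct l) e cj.
have xj : x j = cc *: 'X^(d a * m.-1) by rewrite /x eqxx.
have xt l : x (t l) = cc *: 'X^(2 * d a * (m.-1 - l)).
  rewrite /x (negbTE (tj l)); case: pickP => [l' /eqP/ti -> //|/(_ l)].
  by rewrite eqxx.
have xo i : i != j -> (forall l, t l != i) -> x i = (v i)%:P + ('X - q%:P) * 'X^(D + i).
  move=> ij ti'; rewrite /x (negbTE ij); case: pickP => // l.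
  by rewrite (negbTE (ti' l)).
have cases i : [\/ i = j, exists l, i = t l | i != j /\ forall l, t l != i].
  case: (eqVneq i j) => [->|ij]; first by apply: Or31.
  case: (pickP (fun l => t l == i)) => [l /eqP <-|h]; first by apply: Or32; exists l.
  by apply: Or33; split=> // l; rewrite h.
have szm k : size (cc *: 'X^k) = k.+1 by rewrite size_scale // size_polyXn.
have szo i : size ((v i)%:P + ('X - q%:P) * 'X^(D + i)) = (D + i).+2.
  rewrite addrC size_polyDl size_mulXn ?polyXsubC_eq0 // size_XsubC addn2 //.
  by apply: leq_ltn_trans (size_polyC_leq1 _) _.
have lem (l : 'I_m) : (l <= m.-1)%N by rewrite -ltnS prednK ?ltn_ord.
have szt l : (size (x (t l)) <= D)%N.
  by rewrite xt szm ltnS -(mulnA 2) -mulnA !leq_mul // (leq_trans (leq_subr _ _)) // leq_pred.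
have szj : (size (x j) <= D)%N.
  by rewrite xj szm ltnS leq_mul ?leq_pmull // leq_pred.
exists x; split.
- move=> i; case: (cases i) => [->|[l ->]|[ij ti']].
  + by rewrite xj hornerZ hornerXn divfK // expf_neq0.
  + rewrite xt hornerZ hornerXn; have := hw l; rewrite mE -exprnP -!exprM => hl.
    apply: (mulfI (expf_neq0 (d a * (2 * l)) q0)); rewrite hl mulrCA -exprD.
    have -> : (d a * (2 * l) + 2 * d a * (m.-1 - l) = d a * m.-1 + d a * m.-1)%N.
      by rewrite -{2 3}(subnKC (lem l)); ring.
    by rewrite exprD mulrA divfK ?expf_neq0 // mulrC.
  + by rewrite xo // hornerD hornerC hornerM hornerXsubC subrr mul0r addr0.
(* Coordinates of equal color are separated by degree. The coordinate of [j] may have the degree of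
   some [t l], but their colors differ. *)
- have neq i k : size (x i) != size (x k) -> x i != x k by apply: contraNneq => ->.
  have so i : i != j -> (forall l, t l != i) -> size (x i) = (D + i).+2 by move=> *; rewrite xo.
  have lo i k : (size (x i) <= D)%N -> size (x k) = (D + k).+2 -> size (x i) != size (x k).
    by move=> h ->; rewrite neq_ltn (leq_ltn_trans h) // ltnS ltnW // ltnS leq_addr.
  move=> i k ik cik; apply: neq; move: ik cik.
  case: (cases i) => [->|[l ->]|[ij ti']];
    case: (cases k) => [->|[l' ->]|[kj tk']] //; rewrite ?eqxx //.
  + by rewrite cj ct => _ /esym e; rewrite e eqxx in ab.
  + by move=> _ _; apply: lo => //; apply: so.
  + by rewrite cj ct => _ e; rewrite e eqxx in ab.
  + rewrite (inj_eq ti) -(inj_eq val_inj) => ll _; rewrite !xt !szm eqSS.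
    rewrite eqn_pmul2l ?muln_gt0 ?d_gt0 //; apply: contraNneq ll => e.
    by apply/eqP; move: e (lem l) (lem l') => /=; lia.
  + by move=> _ _; apply: lo => //; apply: so.
  + by move=> _ _; rewrite eq_sym; apply: lo => //; apply: so.
  + by move=> _ _; rewrite eq_sym; apply: lo => //; apply: so.
  + by move=> ik _; rewrite !so // !eqSS eqn_add2l.
have mX k l k' l' : (k + l = k' + l')%N -> 'X^k * (cc *: 'X^l) = 'X^k' * (cc *: 'X^l') :> {poly F}.
  by move=> e; rewrite -!scalerAr -!exprD e.
(* Around the cycle, relative to [E], the kernel exponent is [2 * d a] on each of the [m.-1] links
   inside [t] and [- d a * m.-1] on each of the two links through [j]; the total is 0, so the wheel
   closes up. *)
apply: (word_sum_wheel (t := t) (j := j)) => //.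
- move=> l l' ell; rewrite !xt !ct; apply: mX.
  have -> : absz (E%:Z + Defs.form A d a a) = (E + 2 * d a)%N.
    by rewrite /Defs.form Adiag; lia.
  by rewrite -addnA; congr (E + _)%N; rewrite -mulnS; congr (_ * _)%N; have := lem l'; lia.
- move=> l ml; rewrite xj xt ct cj; apply: mX.
  have := E_ge a b; rewrite /Defs.form (_ : A a b = - (m.-1)%:Z); last by lia.
  rewrite mulrN -PoszM => h; have -> : (m.-1 - l = 0)%N by lia.
  by rewrite muln0 addn0; lia.
- move=> l l0; rewrite xj xt ct cj; apply: mX.
  have := E_ge a b; rewrite /Defs.form Asym l0 subn0 -Asym (_ : A a b = - (m.-1)%:Z); last by lia.
  by rewrite mulrN -PoszM -mulnA; lia.
Qed.

(** The Vandermonde is divided out before specialization: the value at [v] of the specialized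
    quotient is the value at [q] of the generic quotient at the lifted point, which is 0. *)
Lemma word_laurent : exists P k,
  word_sum shuffle_kern [seq letter col z p | p <- w] setT
    = vandermonde * lfrac P k /\ wheel_zero P.
Proof.
have [Q eQ] := P0_div; have [a a0 eS] := spec_P0.
exists (a^-1 *: map_mpoly (horner_eval q) Q), M; split.
  have zM0 : (\prod_i z i) ^+ M != 0.
    by rewrite expf_neq0 //; apply/prodf_neq0 => i _; exact: z0.
  have ca0 : cst a != 0 by rewrite fmorph_eq0.
  have e : spec P0 = vandermonde * tau (map_mpoly (horner_eval q) Q).
    rewrite eQ /spec rmorphM /= rmorph_prod; congr (_ * _).
    rewrite rmorph_prod /= /vandermonde -(prs_prod (fun i j => z i - z j)).
    by apply: eq_bigr => p _; rewrite rmorphB /= !map_mpolyX rmorphB.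
  rewrite /lfrac -mul_mpolyC rmorphM -[tau _%:MP]/(cst a^-1) fmorphV.
  apply: (mulfI (mulf_neq0 ca0 zM0)); rewrite -eS e.
  exact: cancel_denom.
move=> a' b t j v ab cj ti ct v0 hw.
have [x [xv xd xw]] := wheel_lift ab cj ti ct v0 hw.
by rewrite mevalZ (meval_spec Q xv) (P0_point eQ xd xw) horner0 mulr0.
Qed.

End OneWord.
Local Notation free_alg := (malg (fmonom ('I_r * int)%type) F).

Definition shuffle_num (u : free_alg) : ratf :=
  alg_sum cst shuffle_kern (letter col z) u setT.

Let laurentD P P' k k' :
  lfrac P k + lfrac P' k'
    = lfrac (P * (\prod_i 'X_i) ^+ k' + P' * (\prod_i 'X_i) ^+ k) (k + k').
Proof.
have eX : \prod_i z i = tau (\prod_i 'X_i) by rewrite rmorph_prod.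
rewrite /lfrac eX; apply: common_denom.
by rewrite -eX; apply/prodf_neq0 => i _; exact: z0.
Qed.

Lemma shuffle_num_laurent u : exists P k,
  shuffle_num u = vandermonde * lfrac P k /\ wheel_zero P.
Proof.
rewrite /shuffle_num alg_sumE.
elim: (finmap.enum_fset _) => [|m s [P [k [IH hP]]]].
  exists 0, 0%N; rewrite big_nil /lfrac rmorph0 mul0r mulr0; split=> //.
  by move=> *; rewrite meval0.
rewrite big_cons IH; have [P' [k' [-> hP']]] := word_laurent m.
exists (mcoeff m u *: P' * (\prod_i 'X_i) ^+ k + P * (\prod_i 'X_i) ^+ k'), (k' + k)%N; split.
  rewrite -laurentD mulrDr; congr (_ + _).
  by rewrite mulrCA /lfrac -mul_mpolyC rmorphM !mulrA.
move=> a b t j v ab cj ti ct v0 hw.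
have hz := (hP' _ _ _ _ _ ab cj ti ct v0 hw, hP _ _ _ _ _ ab cj ti ct v0 hw).
by rewrite mevalD !mevalM mevalZ !hz mulr0 !mul0r addr0.
Qed.

End WordLaurent.

(** * Shuffles and subsets of the variables *)

Section OrderedEnumeration.

Let ltord p := [rel x y : 'I_p | (x < y)%N].

Let sorted_enum_ord p : sorted (@ltord p) (enum 'I_p).
Proof.
have -> : sorted (@ltord p) (enum 'I_p) = sorted ltn (map val (enum 'I_p)) by rewrite sorted_map.
by rewrite val_enum_ord iota_ltn_sorted.
Qed.

Let sorted_homo N p (h : 'I_N -> 'I_p) : {homo h : x y / (x < y)%N} ->
  sorted (@ltord p) (map h (enum 'I_N)).
Proof. by move=> hm; apply: homo_sorted (sorted_enum_ord N) => x y; apply: hm. Qed.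

Lemma homo_ltn_unique N p (f g : 'I_N -> 'I_p) :
  {homo f : x y / (x < y)%N} -> {homo g : x y / (x < y)%N} ->
  f @: setT = g @: setT -> f =1 g.
Proof.
move=> hf hg e i.
have : map f (enum 'I_N) = map g (enum 'I_N).
  apply: (irr_sorted_eq (leT := @ltord p)); [|by move=> x; rewrite /= ltnn
    |exact: sorted_homo|exact: sorted_homo|].
    by move=> y x z /=; apply: ltn_trans.
  move=> x; have im (h : 'I_N -> 'I_p) : (x \in map h (enum 'I_N)) = (x \in h @: setT).
    by apply/mapP/imsetP => -[j _ ->]; exists j; rewrite ?mem_enum ?inE.
  by rewrite !im e.
by move/eq_in_map; apply; rewrite mem_enum.
Qed.

Lemma exists_enumeration N p (S : {set 'I_p}) : #|S| = N ->
  exists2 h : 'I_N -> 'I_p, {homo h : x y / (x < y)%N} & h @: setT = S.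
Proof.
move=> SN; exists (fun i => enum_val (cast_ord (esym SN) i)).
  move=> x y xy; have x0 := enum_val (cast_ord (esym SN) x).
  rewrite !(enum_val_nth x0) /=.
  have tr : transitive (@ltord p) by move=> u v w /=; apply: ltn_trans.
  have srt : sorted (@ltord p) (enum S) by rewrite /enum_mem -enumT; apply: sorted_filter.
  by apply: (sorted_ltn_nth tr x0 srt); rewrite // inE -cardE SN.
apply/setP => x; apply/imsetP/idP => [[i _ ->]|xS]; first exact: enum_valP.
exists (cast_ord SN (enum_rank_in xS x)) => //.
by rewrite cast_ord_comp cast_ord_id enum_rankK_in.
Qed.

Lemma sorted_count_unique N r (f g : 'I_N -> 'I_r) :
  {homo f : x y / (x <= y)%N} -> {homo g : x y / (x <= y)%N} ->
  (forall a, #|[set i | f i == a]| = #|[set i | g i == a]|) -> f =1 g.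
Proof.
move=> hf hg cfg i.
pose le := [rel x y : 'I_r | (x <= y)%N].
have so (h : 'I_N -> 'I_r) : {homo h : x y / (x <= y)%N} -> sorted le (map h (enum 'I_N)).
  move=> hh; apply: (homo_sorted (e := @ltord N)) (sorted_enum_ord N) => x y /ltnW; exact: hh.
have : map f (enum 'I_N) = map g (enum 'I_N).
  apply: (sorted_eq (leT := le)); [| |exact: so|exact: so|].
  - by move=> y x z /=; apply: leq_trans.
  - by move=> x y /andP[xy yx]; apply/val_inj/anti_leq/andP.
  apply/allP => a _ /=; apply/eqP.
  have cnt (h : 'I_N -> 'I_r) : count_mem a (map h (enum 'I_N)) = #|[set i | h i == a]|.
    rewrite count_map cardE -size_filter; congr (size _).
    by rewrite [RHS]/enum_mem -enumT; apply: eq_filter => j; rewrite !inE.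
  by rewrite !cnt cfg.
by move/eq_in_map; apply; rewrite mem_enum.
Qed.

End OrderedEnumeration.

Section ShuffleTerm.
Variables (K : fieldType) (P : nat) (qd : 'I_P -> 'I_P -> K).
Hypothesis qd0 : forall x y, x != y -> qd x y != 0.

(** Pairs inside [S] or inside its complement are never inverted, so the signature and the product
    over inversions reduce to pairs across [S]. *)
Lemma shuffle_term (L S : {set 'I_P}) (s : 'S_P) :
  s @: L = S -> {in L &, {homo s : x y / (x < y)%N}} ->
  {in ~: L &, {homo s : x y / (x < y)%N}} ->
  (forall x y, x \in L -> y \notin L -> (x < y)%N) ->
  (-1) ^+ odd_perm s
    * (\prod_(i < P) \prod_(j < P | (i < j)%N && ((s^-1)%g j < (s^-1)%g i)%N) (qd i j / qd j i))
    / (pair_prod (fun i j => qd j i) S * pair_prod (fun i j => qd j i) (~: S))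
  = (\prod_(x in S) \prod_(y in ~: S) ((-1) ^+ (y < x)%N * qd y x))
    / pair_prod (fun i j => qd j i) setT.
Proof.
move=> sL hL hR LR.
have smem x : (s x \in S) = (x \in L) by rewrite -sL mem_imset //; exact: perm_inj.
have smem' x : ((s^-1)%g x \in L) = (x \in S) by rewrite -smem permKV.
have sC : ~: S = s @: (~: L).
  apply/setP => y; rewrite inE -[y](permKV s) mem_imset ?inE ?smem //; exact: perm_inj.
have sgE : (-1) ^+ odd_perm s = \prod_(x in S) \prod_(y in ~: S) (-1) ^+ (y < x)%N :> K.
  rewrite -pair_prod_sign (pair_prod_split _ (subsetT L)) setTD.
  have one (A : {set 'I_P}) : {in A &, {homo s : x y / (x < y)%N}} ->
      pair_prod (fun x y => (-1) ^+ (s y < s x)%N) A = 1 :> K.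
    move=> hA; rewrite /pair_prod big1 // => x xA; rewrite big1 // => y /andP[yA xy].
    by rewrite ltnNge (ltnW (hA _ _ xA yA xy)).
  rewrite !one // !mul1r -sL big_imset /=; last by move=> ? ? _ _; exact: perm_inj.
  apply: eq_bigr => x xL; rewrite sL sC big_imset /=; last by move=> ? ? _ _; exact: perm_inj.
  by apply: eq_bigr => y; rewrite inE => yL; rewrite LR.
have invE : \prod_(i < P) \prod_(j < P | (i < j)%N && ((s^-1)%g j < (s^-1)%g i)%N) (qd i j / qd j i)
   = \prod_(x in S) \prod_(y in ~: S) (if (x < y)%N then 1 else qd y x / qd x y).
  transitivity (pair_prod (fun i j =>
      if ((s^-1)%g j < (s^-1)%g i)%N then qd i j / qd j i else 1) setT).
    by rewrite pair_prodT; apply: eq_bigr => i _; rewrite big_mkcondr.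
  rewrite (pair_prod_split _ (subsetT S)) setTD.
  have one (A : {set 'I_P}) (B : {set 'I_P}) : (forall x, x \in B -> (s^-1)%g x \in A) ->
      {in A &, {homo s : x y / (x < y)%N}} ->
      pair_prod (fun i j => if ((s^-1)%g j < (s^-1)%g i)%N then qd i j / qd j i else 1) B = 1 :> K.
    move=> BA hA; rewrite /pair_prod big1 // => x xB; rewrite big1 // => y /andP[yB xy].
    by case: ltnP => // /(hA _ _ (BA _ yB) (BA _ xB)); rewrite !permKV ltnNge (ltnW xy).
  rewrite (one L S) ?(one (~: L) (~: S)) ?mul1r //; first last.
  - by move=> x; rewrite smem'.
  - by move=> x; rewrite !inE smem'.
  apply: eq_bigr => x xS; apply: eq_bigr => y; rewrite inE => yS.
  have h : ((s^-1)%g x < (s^-1)%g y)%N by apply: LR; rewrite smem'.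
  by rewrite h [((s^-1)%g y < (s^-1)%g x)%N]ltnNge (ltnW h).
have nz (A : {set 'I_P}) : pair_prod (fun i j => qd j i) A != 0.
  apply/prodf_neq0 => i _; apply/prodf_neq0 => j /andP[_ ij]; apply: qd0.
  by rewrite -(inj_eq val_inj) neq_ltn ij orbT.
rewrite (pair_prod_split _ (subsetT S)) setTD sgE invE.
(* [C] is the part of the full denominator coming from the pairs across [S]; multiplied by it, each
   inversion factor becomes [qd y x], whatever the order of [x] and [y]. *)
set C := \prod_(x in S) \prod_(y in ~: S) (if _ then qd y x else _).
have C0 : C != 0.
  apply/prodf_neq0 => x xS; apply/prodf_neq0 => y; rewrite inE => yS.
  have xy : x != y by apply: contraNneq yS => <-.
  by case: ifP => _; apply: qd0; rewrite // eq_sym.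
have -> : \prod_(x in S) \prod_(y in ~: S) ((-1) ^+ (y < x)%N * qd y x)
  = \prod_(x in S) \prod_(y in ~: S) (-1) ^+ (y < x)%N
    * \prod_(x in S) \prod_(y in ~: S) (if (x < y)%N then 1 else qd y x / qd x y) * C.
  rewrite -!big_split; apply: eq_bigr => x xS /=; rewrite -!big_split.
  apply: eq_bigr => y; rewrite inE => yS /=.
  have xy : x != y by apply: contraNneq yS => <-.
  by case: ifP => _; [rewrite mulr1 | rewrite -mulrA divfK ?qd0].
by field; rewrite !nz C0.
Qed.

End ShuffleTerm.

Section Shuffles.
Variable r : nat.
Local Notation degree := {ffun 'I_r -> nat}.
Local Notation idx n := 'I_(\sum_a n a)%N.

Lemma color_homo (n : degree) : {homo @color r n : i j / (i <= j)%N}.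
Proof. by move=> i j; exact: tagnat.le_sig1. Qed.

Lemma card_color (n : degree) a : #|[set i : idx n | color i == a]| = n a.
Proof.
have -> : [set i : idx n | color i == a] = (fun k : 'I_(n a) => tagnat.Rank a k) @: setT.
  apply/setP => i; rewrite inE; apply/eqP/imsetP => [ia|[k _ ->]].
    have := tagnat.sig2K i; move: (tagnat.sig2 i); rewrite -/(color i) ia => k <-.
    by exists k.
  exact: tagnat.Rank1K.
rewrite card_imset ?cardsT ?card_ord //.
by move=> k k' /eqP; rewrite -(inj_eq val_inj) tagnat.eq_Rank eqxx => /eqP/val_inj.
Qed.

Definition has_degree (p n : degree) (S : {set idx p}) : bool :=
  [forall a, #|[set x in S | color x == a]| == n a].

Lemma card_has_degree (p n : degree) (S : {set idx p}) :
  has_degree n S -> #|S| = (\sum_a n a)%N.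
Proof.
move/forallP => h; rewrite -sum1_card (partition_big (@color r p) xpredT) //=.
apply: eq_bigr => a _; rewrite -(eqP (h a)) -sum1_card; apply: eq_bigl => x.
by rewrite !inE.
Qed.

(** Indices are sorted by color, so the colors along [h] and those of degree [n] are two
    nondecreasing sequences with the same multiplicities. *)
Lemma color_enumeration (p n : degree) (S : {set idx p}) (h : idx n -> idx p) :
  has_degree n S -> {homo h : x y / (x < y)%N} -> h @: setT = S ->
  forall i, color (h i) = color i.
Proof.
move/forallP => hS hh hT; apply: sorted_count_unique => [x y xy||a].
- apply: color_homo; move: xy; rewrite leq_eqVlt => /orP[/eqP/val_inj ->|/hh/ltnW] //.
- exact: color_homo.
rewrite card_color -(eqP (hS a)) -hT -(card_imset _ (homo_ltn_inj hh)).
congr #|pred_of_set _|; apply/setP => x; rewrite !inE; apply/imsetP/andP.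
  by case=> i; rewrite inE => ia ->; rewrite imset_f.
by case=> /imsetP[i _ ->] ia; exists i; rewrite ?inE.
Qed.

Variables n m p : degree.
Hypothesis npm : forall a, (n a + m a = p a)%N.
Local Notation lp := (lpos npm).
Local Notation rp := (rpos npm).

Lemma lpos_rpos i j : (lp i < rp j)%N.
Proof. by rewrite /= ltn_addr. Qed.

Lemma posP x : (exists i, x = lp i) \/ (exists j, x = rp j).
Proof.
rewrite -[x](cast_ordKV (size_split npm)).
case: (split_ordP (cast_ord (esym (size_split npm)) x)) => [i ->|j ->].
  by left; exists i.
by right; exists j.
Qed.

Definition left_image (s : 'S_(\sum_a p a)) : {set idx p} := (fun i => s (lp i)) @: setT.

Lemma right_image (s : 'S_(\sum_a p a)) :
  (fun j => s (rp j)) @: setT = ~: left_image s.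
Proof.
apply/setP => y; rewrite inE; apply/imsetP/idP => [[j _ ->]|].
  apply/imsetP => -[i _ /perm_inj e].
  by have := lpos_rpos i j; rewrite e ltnn.
rewrite -[y](permKV s); case: (posP ((s^-1)%g y)) => [[i ->]|[j ->]].
  by rewrite imset_f.
by exists j.
Qed.

Section OneShuffle.
Variable s : 'S_(\sum_a p a).
Hypothesis hs : is_shuffle npm s.

Lemma shuffle_color_l i : color (s (lp i)) = color i.
Proof.
have /and3P[/forallP/(_ (color i))/eqP e _ _] := hs.
have : s (lp i) \in [set x | color x == color i].
  by rewrite e inE; apply/orP; left; rewrite !imset_f ?inE.
by rewrite inE => /eqP.
Qed.

Lemma shuffle_color_r j : color (s (rp j)) = color j.
Proof.
have /and3P[/forallP/(_ (color j))/eqP e _ _] := hs.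
have : s (rp j) \in [set x | color x == color j].
  by rewrite e inE; apply/orP; right; rewrite !imset_f ?inE.
by rewrite inE => /eqP.
Qed.

(** [is_shuffle] requires monotonicity only inside each color; between colors it follows because
    indices are sorted by color. *)
Let homo_of (k : degree) (h : idx k -> idx p) :
  (forall i, color (h i) = color i) ->
  (forall i i', color i = color i' -> (i < i')%N -> (h i < h i')%N) ->
  {homo h : x y / (x < y)%N}.
Proof.
move=> hc hlt i i' ii'; case: (eqVneq (color i) (color i')) => [e|ne]; first exact: hlt.
rewrite ltnNge; apply/negP => /color_homo; rewrite !hc => h'.
have := color_homo (ltnW ii') => h''.
by case/eqP: ne; apply/val_inj/anti_leq; rewrite h' h''.
Qed.

Lemma shuffle_homo_l : {homo (fun i => s (lp i)) : x y / (x < y)%N}.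
Proof.
apply: homo_of; first exact: shuffle_color_l.
have /and3P[_ /forallP h _] := hs => i i' c ii'.
by have /implyP := forallP (h i) i'; apply; rewrite c eqxx.
Qed.

Lemma shuffle_homo_r : {homo (fun j => s (rp j)) : x y / (x < y)%N}.
Proof.
apply: homo_of; first exact: shuffle_color_r.
have /and3P[_ _ /forallP h] := hs => i i' c ii'.
by have /implyP := forallP (h i) i'; apply; rewrite c eqxx.
Qed.

Lemma left_image_degree : has_degree n (left_image s).
Proof.
apply/forallP => a; rewrite -(card_color n a) -(card_imset _ (homo_ltn_inj shuffle_homo_l)).
apply/eqP; congr #|pred_of_set _|; apply/setP => x; rewrite !inE; apply/andP/imsetP.
  by case=> /imsetP[i _ ->]; rewrite shuffle_color_l => ia; exists i; rewrite ?inE.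
by case=> i; rewrite inE => ia ->; rewrite imset_f // shuffle_color_l.
Qed.

End OneShuffle.

Lemma left_image_inj : {in [set s | is_shuffle npm s] &, injective left_image}.
Proof.
move=> s s'; rewrite !inE => hs hs' e.
have el := homo_ltn_unique (shuffle_homo_l hs) (shuffle_homo_l hs') e.
have er : (fun j => s (rp j)) =1 (fun j => s' (rp j)).
  apply: homo_ltn_unique (shuffle_homo_r hs) (shuffle_homo_r hs') _.
  by rewrite !right_image e.
by apply/permP => x; case: (posP x) => [[i ->]|[j ->]]; [exact: el | exact: er].
Qed.

Lemma exists_shuffle S : has_degree n S -> exists2 s, is_shuffle npm s & left_image s = S.
Proof.
move=> hS; have hS' : has_degree m (~: S).
  apply/forallP => a; apply/eqP/(@addnI (n a)); rewrite npm -(eqP (forallP hS a)).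
  rewrite -(card_color p a) -cardsUI -[RHS]addn0; congr (_ + _)%N.
    by apply: eq_card => x; rewrite !inE -andb_orl orbN.
  by apply/eqP; rewrite cards_eq0; apply/eqP/setP => x;
    rewrite !inE; case: (x \in S); rewrite ?andbF.
have [hl homl iml] := exists_enumeration (card_has_degree hS).
have [hr homr imr] := exists_enumeration (card_has_degree hS').
have cl := color_enumeration hS homl iml.
have cr := color_enumeration hS' homr imr.
pose f (x : idx p) : idx p := match split (cast_ord (esym (size_split npm)) x) with
  | inl i => hl i | inr j => hr j end.
have fl i : f (lp i) = hl i.
  by rewrite /f /lpos cast_ordK;
    case: split_ordP => [i' /lshift_inj -> //|j /eqP]; rewrite eq_lrshift.
have fr j : f (rp j) = hr j.
  by rewrite /f /rpos cast_ordK;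
    case: split_ordP => [i /eqP|j' /rshift_inj -> //]; rewrite eq_rlshift.
have lr i j : hl i <> hr j.
  move=> e; have : hr j \in ~: S by rewrite -imr imset_f.
  by rewrite inE -e -iml imset_f.
have fi : injective f.
  move=> x y; case: (posP x) => [[i ->]|[j ->]];
    case: (posP y) => [[i' ->]|[j' ->]]; rewrite ?fl ?fr.
  - by move/(homo_ltn_inj homl) ->.
  - by move/lr.
  - by move/esym/lr.
  - by move/(homo_ltn_inj homr) ->.
exists (perm fi); last first.
  by rewrite /left_image -iml; apply: eq_imset => i; rewrite permE fl.
apply/and3P; split.
- apply/forallP => a; apply/eqP/setP => x; rewrite !inE; apply/idP/orP.
    rewrite -[x](permKV (perm fi)); case: (posP (((perm fi)^-1)%g x)) => [[i ->]|[j ->]].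
      by rewrite permE fl cl => ia; left; rewrite -fl -(permE fi) !imset_f ?inE.
    by rewrite permE fr cr => ja; right; rewrite -fr -(permE fi) !imset_f ?inE.
  case=> /imsetP[y /imsetP[i ia ->] ->]; rewrite inE in ia; rewrite permE.
    by rewrite fl cl.
  by rewrite fr cr.
- apply/forallP => i; apply/forallP => i'; apply/implyP => /andP[_ ii'].
  by rewrite !permE !fl homl.
- apply/forallP => i; apply/forallP => i'; apply/implyP => /andP[_ ii'].
  by rewrite !permE !fr homr.
Qed.

(** Shuffles correspond bijectively to the sets of variables given to the left factor, which is the
    form of the sum in [word_sum_cat]. *)
Lemma big_shuffle (V : nmodType) (H : {set idx p} -> V) :
  \sum_(s : 'S_(\sum_a p a) | is_shuffle npm s) H (left_image s)
    = \sum_(S : {set idx p} | has_degree n S) H S.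
Proof.
transitivity (\sum_(S in left_image @: [set s | is_shuffle npm s]) H S).
  rewrite big_imset /=; last exact: left_image_inj.
  by apply: eq_bigl => s; rewrite inE.
apply: eq_bigl => S; apply/imsetP/idP => [[s]|hS].
  by rewrite inE => hs ->; exact: left_image_degree.
by have [s hs <-] := exists_shuffle hS; exists s; rewrite ?inE.
Qed.

End Shuffles.

Lemma alg_sum_morph (F K K' : fieldType) (f : {rmorphism K -> K'})
    (emb : {rmorphism F -> K}) (emb' : {rmorphism F -> K'})
    (I : choiceType) (T : finType) (G : T -> T -> K) (wt : I -> T -> K) u (X : {set T}) :
  (forall a, f (emb a) = emb' a) ->
  f (alg_sum emb G wt u X)
    = alg_sum emb' (fun x y => f (G x y)) (fun p x => f (wt p x)) u X.
Proof.
move=> fe; rewrite !alg_sumE rmorph_sum; apply: eq_bigr => w _.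
by rewrite rmorphM fe rmorph_word_sum -map_comp.
Qed.

Lemma alg_sum_mono (F K : fieldType) (emb : {rmorphism F -> K}) (r N p : nat)
    (h : 'I_N -> 'I_p) (c : 'I_p -> 'I_r) (kap : 'I_r -> 'I_r -> K) (e : K)
    (z : 'I_p -> K) u (X : {set 'I_N}) : {homo h : x y / (x < y)%N} ->
  alg_sum emb (kern c kap e z) (letter c z) u (h @: X)
    = alg_sum emb (kern (c \o h) kap e (z \o h)) (letter (c \o h) (z \o h)) u X.
Proof.
move=> hm; rewrite !alg_sumE; apply: eq_bigr => w _.
by rewrite (word_sum_mono _ _ _ _ _ _ hm) -map_comp.
Qed.

Lemma alg_sum_perm (F K : fieldType) (emb : {rmorphism F -> K}) (r N : nat)
    (s : 'S_N) (c : 'I_N -> 'I_r) (kap : 'I_r -> 'I_r -> K) (e : K) (z : 'I_N -> K) u :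
  (forall x, c (s x) = c x) ->
  alg_sum emb (kern c kap e (z \o s)) (letter c (z \o s)) u setT
    = (-1) ^+ odd_perm s * alg_sum emb (kern c kap e z) (letter c z) u setT.
Proof.
move=> cs; rewrite !alg_sumE mulr_sumr; apply: eq_bigr => w _.
rewrite [in RHS]mulrCA -(word_sum_perm kap e z _ cs) -map_comp.
congr (_ * word_sum _ _ _); apply/eq_in_map => q _; apply/funext => x /=.
by rewrite /letter cs.
Qed.

(** A letter is nonzero only on variables of its color, so a word contributes to a single degree;
    this gives the finite support of the images. *)
Lemma word_sum_degree (K : fieldType) (r N : nat) (c : 'I_N -> 'I_r) (z : 'I_N -> K)
    (G : 'I_N -> 'I_N -> K) (w : seq ('I_r * int)) (X : {set 'I_N}) a :
  #|[set x in X | c x == a]| != count (fun p => p.1 == a) w ->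
  word_sum G [seq letter c z p | p <- w] X = 0.
Proof.
elim: w X => [|p w IH] X /=.
  move=> ne; case: eqP => [X0|//]; case/eqP: ne.
  by apply/eqP; rewrite cards_eq0; apply/eqP/setP => x; rewrite X0 !inE.
move=> ne; apply: big1 => x xX; rewrite {1}/letter; case: eqP => [cx|_]; last by rewrite !mul0r.
rewrite IH ?mulr0 //; apply: contraNneq ne => <-.
have -> : [set y in X :\ x | c y == a] = [set y in X | c y == a] :\ x.
  by apply/setP => y; rewrite !inE andbA.
by rewrite (cardsD1 x [set y in X | c y == a]) !inE xX cx.
Qed.

Lemma pair_prod_vandermonde (K : comNzRingType) (r N : nat) (c : 'I_N -> 'I_r)
    (z : 'I_N -> K) (s : 'S_N) :
  {homo c : i j / (i <= j)%N} -> (forall i, c (s i) = c i) ->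
  \prod_(i < N) \prod_(j < N | (i < j)%N && (c i == c j)) (z (s i) - z (s j))
    = (-1) ^+ odd_perm s
      * \prod_(i < N) \prod_(j < N | (i < j)%N && (c i == c j)) (z i - z j).
Proof.
(* Pairs of distinct colors receive signs that make [t] antisymmetric; since [s] never inverts such
   pairs, these signs are 1 on both sides. *)
move=> cm cs; pose t i j := if c i == c j then z i - z j else (-1) ^+ (j < i)%N.
have tA x y : x != y -> t y x = - t x y.
  move=> xy; rewrite /t eq_sym; case: eqP => _; first by rewrite opprB.
  case: (ltngtP x y) => [_|_|/val_inj exy]; rewrite ?expr0 ?expr1 ?opprK //.
  by rewrite exy eqxx in xy.
have e0 (f : 'I_N -> 'I_N -> K) : \prod_(i < N) \prod_(j < N | (i < j)%N && (c i == c j)) f i j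
    = pair_prod (fun i j => if c i == c j then f i j else 1) setT.
  by rewrite pair_prodT; apply: eq_bigr => i _; rewrite big_mkcondr.
rewrite !e0; have := pair_prod_alt s tA.
have -> : pair_prod t setT = pair_prod (fun i j => if c i == c j then z i - z j else 1) setT.
  by apply: eq_pair_prod => x y _ _ xy; rewrite /t ltnNge (ltnW xy).
move=> <-; apply: eq_pair_prod => x y _ _ xy; rewrite /t !cs; case: eqP => // ne.
rewrite ltnNge; case: leqP => // sxy; case: ne; apply/val_inj/anti_leq.
by rewrite (cm _ _ (ltnW xy)) -(cs x) -(cs y) (cm _ _ (ltnW sxy)).
Qed.

Lemma prod_singleton (K : comNzRingType) (T : finType) (x : T) (f : T -> K) :
  [set: T] = [set x] -> \prod_i f i = f x.
Proof.
move=> e; transitivity (\prod_(i in [set x]) f i); last by rewrite big_set1.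
by rewrite -e; apply: eq_bigl => i; rewrite inE.
Qed.

(** * The morphism *)

Section ShuffleMorphism.
Variables (F : fieldType) (r : nat) (A : 'M[int]_r) (d : 'I_r -> nat) (q : F).
Hypothesis q0 : q != 0.
Hypothesis two_neq0 : 2 != 0 :> F.
Hypothesis Adiag : forall i, A i i = 2.
Hypothesis Aoff : forall i j, i != j -> (A i j <= 0)%R.
Hypothesis Asym : forall i j, (d i)%:Z * A i j = (d j)%:Z * A j i.
Hypothesis d_gt0 : forall i, (0 < d i)%N.
Local Notation degree := {ffun 'I_r -> nat}.
Local Notation idx n := 'I_(\sum_a n a)%N.
Local Notation ratf n := {fraction {mpoly F[\sum_a n a]}}.
Local Notation free_alg := (malg (fmonom ('I_r * int)%type) F).

Definition tofrac_rmorphism (n : degree) : {rmorphism {mpoly F[\sum_a n a]} -> ratf n} :=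
  @tofrac _.
Local Notation tau := tofrac_rmorphism.

Definition cst_rmorphism (n : degree) : {rmorphism F -> ratf n} := tau n \o @mpolyC _ _.

Definition deg_kern (n : degree) : idx n -> idx n -> ratf n :=
  kern (@color r n) (fun a b => cst n (q ^ Defs.form A d a b)) 1 (@z F r n).

Definition deg_sum (n : degree) (u : free_alg) (S : {set idx n}) : ratf n :=
  alg_sum (cst_rmorphism n) (@deg_kern n) (letter (@color r n) (@z F r n)) u S.

Definition qden (n : degree) (S : {set idx n}) : ratf n :=
  pair_prod (fun i j => qdiff A d q j i) S.

Definition free_pi (u : free_alg) : ratfam F r := fun n =>
  deg_sum u setT / qden [set: idx n].

Lemma z_neq0 (n : degree) (i : idx n) : z F i != 0.
Proof.
rewrite tofrac_eq0; apply/eqP => /(congr1 (meval (fun=> 1))).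
by rewrite mevalXU meval0; apply/eqP; rewrite oner_eq0.
Qed.

Lemma qdiff_neq0 (n : degree) (i j : idx n) : i != j -> qdiff A d q i j != 0.
Proof.
move=> ij; rewrite /qdiff /cst /z -tofracM -tofracB tofrac_eq0.
apply/eqP => /(congr1 (meval (fun k => (k == j)%:R))).
rewrite mevalB mevalM !mevalXU mevalC meval0 eqxx (negbTE ij) mulr0 sub0r.
by move/eqP; rewrite oppr_eq0 oner_eq0.
Qed.

(** The symmetry of the form reconciles the order of the colors in [kern] with that in [qdiff]. *)
Lemma deg_kernE (n : degree) (x y : idx n) :
  deg_kern x y = (-1) ^+ (y < x)%N * qdiff A d q y x.
Proof.
by rewrite /deg_kern /kern /qdiff mul1r /Defs.form Asym.
Qed.

Lemma rename_deg_sum (n p : degree) (h : idx n -> idx p) u :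
  {homo h : x y / (x < y)%N} -> (forall i, color (h i) = color i) ->
  rename h (deg_sum u setT) = deg_sum u (h @: setT).
Proof.
move=> hm hc; pose f := rename_inj (F := F) (homo_ltn_inj hm).
have fc a : f (cst_rmorphism n a) = cst_rmorphism p a by exact: rename_cst.
have hcE : @color r p \o h = @color r n by apply/funext => i; exact: hc.
apply: etrans (alg_sum_morph _ _ _ _ fc) _; rewrite /deg_sum /deg_kern alg_sum_mono // hcE.
congr (alg_sum _ _ _ _ _).
  apply/funext => x; apply/funext => y; rewrite /kern rmorphM rmorphB !rmorphM.
  by rewrite rmorphXn rmorphN1 rmorph1 /= !rename_z rename_cst.
apply/funext => l; apply/funext => x; rewrite /letter /=.
by case: eqP => _; rewrite ?rmorph0 // fmorphXz /= rename_z.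
Qed.

Lemma rename_qden (n p : degree) (h : idx n -> idx p) :
  {homo h : x y / (x < y)%N} -> (forall i, color (h i) = color i) ->
  rename h (qden [set: idx n]) = qden (h @: setT).
Proof.
move=> hm hc; pose f := rename_inj (F := F) (homo_ltn_inj hm).
apply: etrans (rmorph_pair_prod f _ _) _; rewrite /qden (pair_prod_imset _ _ hm).
apply: eq_pair_prod => i j _ _ _; rewrite /qdiff rmorphB rmorphM /=.
by rewrite !rename_z rename_cst !hc.
Qed.

Lemma rename_free_pi (n p : degree) (h : idx n -> idx p) u :
  {homo h : x y / (x < y)%N} -> (forall i, color (h i) = color i) ->
  rename h (free_pi u n) = deg_sum u (h @: setT) / qden (h @: setT).
Proof.
move=> hm hc; rewrite -rename_deg_sum // -rename_qden //.
pose f := rename_inj (F := F) (homo_ltn_inj hm).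
exact: (fmorph_div f).
Qed.

Let regroup (K : fieldType) (R a b C e U V : K) :
  R / (a * b) = C / e -> R * (U / a) * (V / b) = C * U * V / e.
Proof.
move=> h; transitivity (R / (a * b) * (U * V)); last by rewrite h; ring.
by rewrite invfM; ring.
Qed.

Lemma shuffle_hom_free_pi (n m p : degree) (npm : forall a, (n a + m a = p a)%N) u v :
  shuffle_hom A d q npm (free_pi u n) (free_pi v m)
    = (\sum_(S : {set idx p} | has_degree n S)
        (\prod_(x in S) \prod_(y in ~: S) deg_kern x y) * deg_sum u S * deg_sum v (~: S))
      / qden [set: idx p].
Proof.
rewrite mulr_suml -(big_shuffle npm); apply: eq_bigr => s hs.
rewrite (rename_free_pi _ (shuffle_homo_l hs) (shuffle_color_l hs)).
rewrite (rename_free_pi _ (shuffle_homo_r hs) (shuffle_color_r hs)) right_image.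
rewrite -/(left_image npm s); apply: regroup.
have := shuffle_term (@qdiff_neq0 p) (L := lpos npm @: setT) (S := left_image npm s) (s := s).
rewrite -/(qden _) -/(qden (~: _)) -/(qden setT).
have ml x : (x \in lpos npm @: setT) = [exists i, x == lpos npm i].
  apply/imsetP/existsP => [[i _ ->]|[i /eqP ->]]; first by exists i.
  by exists i; rewrite ?inE.
move=> -> //.
- congr (_ / _); apply: eq_bigr => x _; apply: eq_bigr => y _.
  by rewrite deg_kernE.
- by rewrite /left_image -imset_comp.
- by move=> x y /imsetP[i _ ->] /imsetP[j _ ->] ij; apply: shuffle_homo_l.
- move=> x y; rewrite !inE !ml => hx hy.
  case: (posP npm x) => [[i ei]|[i ->]]; first by case/existsP: hx; exists i; rewrite ei.
  case: (posP npm y) => [[j ej]|[j ->]]; first by case/existsP: hy; exists j; rewrite ej.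
  by move=> ij; apply: shuffle_homo_r; move: ij; rewrite /= ltn_add2l.
- move=> x y /imsetP[i _ ->]; rewrite ml.
  case: (posP npm y) => [[j ->]|[j -> _]]; last exact: lpos_rpos.
  by case/existsP; exists j.
Qed.

(** Every set of variables has exactly one degree, bounded by [p]. This merges the sum over
    decompositions of [p] and the sums over shuffles into one sum over all subsets. *)
Lemma has_degree_ldeg (p : degree) (S : {set idx p}) (V : nmodType) (a : V) :
  \sum_(n : {dffun forall a : 'I_r, 'I_(p a).+1} | has_degree (ldeg n) S) a = a.
Proof.
have lt b : (#|[set x in S | color x == b]| < (p b).+1)%N.
  by rewrite ltnS -(card_color p b) subset_leq_card //; apply/subsetP => x; rewrite !inE => /andP[].
pose n0 : {dffun forall a : 'I_r, 'I_(p a).+1} := [ffun b => Ordinal (lt b)].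
rewrite (big_pred1 n0) // => n; apply/forallP/eqP => [h|-> b]; last by rewrite !ffunE.
by apply/ffunP => b; apply/val_inj; rewrite ffunE /= (eqP (h b)) ffunE.
Qed.

Lemma free_piM u v p : free_pi (u * v) p = shuffle A d q (free_pi u) (free_pi v) p.
Proof.
rewrite /shuffle; under [RHS]eq_bigr do rewrite shuffle_hom_free_pi.
rewrite -mulr_suml /free_pi {1}/deg_sum alg_sumM; congr (_ / _).
rewrite [RHS](exchange_big_dep xpredT) //=; apply: eq_big => [S|S _]; first exact: subsetT.
by rewrite has_degree_ldeg setTD.
Qed.

Lemma free_pi_lin c u v n : free_pi (c *: u + v) n = cst n c * free_pi u n + free_pi v n.
Proof. by rewrite /free_pi /deg_sum alg_sumD alg_sumZ mulrDl mulrA. Qed.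

Lemma free_piB u v n : free_pi (u - v) n = free_pi u n - free_pi v n.
Proof. by rewrite /free_pi /deg_sum alg_sumB mulrBl. Qed.

Lemma free_pi_rel u n : rel_ideal A d q u -> free_pi u n = 0.
Proof.
move=> hu; rewrite /free_pi /deg_sum.
rewrite (alg_sum_rel_ideal (cst_rmorphism n) q0 Adiag Aoff Asym _ _ (@z_neq0 n) hu) ?mul0r //.
by rewrite -(rmorph_nat (cst_rmorphism n)) fmorph_eq0.
Qed.

Definition word_degree (w : seq ('I_r * int)) : degree :=
  [ffun a => count (fun p : 'I_r * int => p.1 == a) w].

Lemma card_colorT (n : degree) a : #|[set x in [set: idx n] | color x == a]| = n a.
Proof. by rewrite -[RHS](card_color n a); apply: eq_card => x; rewrite !inE. Qed.

Lemma free_pi_degree u n :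
  free_pi u n != 0 ->
  n \in [seq word_degree (m : fmonom ('I_r * int)%type) | m <- finmap.enum_fset (msupp u)].
Proof.
apply: contraR => hn; rewrite /free_pi /deg_sum alg_sum_eq0 ?mul0r // => m mu.
have : n != word_degree m.
  by apply: contraNneq hn => ->; apply/mapP; exists m.
case: (pickP (fun a => n a != count (fun p : 'I_r * int => p.1 == a) m)) => [a na _|e].
  apply: (@word_sum_degree _ _ _ _ _ _ _ _ a).
  by rewrite card_colorT.
by case/eqP; apply/ffunP => a; rewrite ffunE; have /negbFE/eqP := e a.
Qed.

Lemma free_pi_finsupp u : finsupp (free_pi u).
Proof.
eexists => n; apply: contraNeq; exact: free_pi_degree.
Qed.

Lemma free_pi1 n : free_pi 1 n = shuffle_one F n.
Proof.
have T0 : ([set: idx n] == set0) = (n == [ffun => 0%N]).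
  rewrite -cards_eq0 cardsT card_ord sum_nat_eq0.
  apply/forallP/eqP => [h|-> a]; last by rewrite ffunE.
  by apply/ffunP => a; rewrite ffunE; apply/eqP/h.
rewrite /free_pi /deg_sum alg_sum1 T0 /shuffle_one; case: eqP => [e|_]; last by rewrite mul0r.
have -> : [set: idx n] = set0 by apply/eqP; rewrite T0 e.
by rewrite /qden /pair_prod big_set0 divr1.
Qed.

Lemma free_pi_gen a k n : free_pi (free_gen F a k) n = zpow F a k n.
Proof.
rewrite /free_pi /deg_sum /free_gen alg_sumU rmorph1 mul1r fmU /zpow.
case: eqP => [e|ne]; last first.
  case: (pickP (fun b => n b != (b == a)%N)) => [b nb|h]; last first.
    by case: ne; apply/ffunP => b; rewrite ffunE; have /negbFE/eqP := h b.
  rewrite (@word_sum_degree _ _ _ _ _ _ [:: (a, k)] _ b) ?mul0r //= addn0 eq_sym.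
  by rewrite card_colorT (eq_sym a) eq_sym.
have N1 : (\sum_a n a = 1)%N.
  rewrite e (bigD1 a) //= ffunE eqxx big1 // => b /negbTE ba.
  by rewrite ffunE ba.
have /cards1P[i0 T1] : #|[set: idx n]| == 1%N by rewrite cardsT card_ord N1.
have ci0 : color i0 = a.
  have : #|[set i : idx n | color i == a]| = 1%N by rewrite card_color e ffunE eqxx.
  move/eqP/cards1P => [i /setP/(_ i)]; rewrite !inE eqxx => /eqP <-.
  by have := in_setT i; rewrite T1 => /set1P ->.
rewrite /= /letter_op T1 !big_set1 setDv big_set0 eqxx !mulr1 /letter ci0 eqxx /=.
rewrite /qden pair_prod1 divr1.
by apply/esym/(prod_singleton (fun i => z F i ^ k)).
Qed.

Definition deg_vandermonde (n : degree) : ratf n :=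
  \prod_(i : idx n) \prod_(j : idx n | (i < j)%N && (color i == color j)) (z F i - z F j).

Lemma deg_vandermonde_neq0 n : deg_vandermonde n != 0.
Proof.
apply/prodf_neq0 => i _; apply/prodf_neq0 => j /andP[ij _].
by rewrite /z -tofracB tofrac_eq0 mpolyXU_neq // -(inj_eq val_inj) neq_ltn ij.
Qed.

Lemma deg_sum_laurent u (n : degree) : exists P k,
  deg_sum u [set: idx n] = deg_vandermonde n * laurent_frac P k
  /\ wheel_zero A d q (@color r n) P.
Proof.
have [P [k [e wz]]] := shuffle_num_laurent q0 two_neq0 Adiag Aoff Asym d_gt0
  (@color r n) (tau := tau n) (@z_neq0 n) u.
exists P, k; split; last exact: wz.
have eP : lfrac (tau n) P k = laurent_frac P k.
  rewrite /lfrac /laurent_frac.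
  have -> : \prod_i tau n 'X_i = \prod_(i : idx n) z F i by [].
  by [].
have eV : vandermonde (@color r n) (tau n) = deg_vandermonde n by [].
have eK : shuffle_kern A d q (@color r n) (tau n) = @deg_kern n.
  apply/funext => x; apply/funext => y; rewrite /shuffle_kern /deg_kern /kern.
  congr (_ * _).
have eL : letter (@color r n) (fun i => tau n 'X_i) = letter (@color r n) (@z F r n) by [].
have eS : shuffle_num A d q (@color r n) (tau n) u = deg_sum u [set: idx n].
  by rewrite /shuffle_num eK eL.
by rewrite -eS -eV -eP.
Qed.

Lemma rename_perm_deg_sum u (n : degree) (s : 'S_(\sum_a n a)) :
  (forall i : idx n, color (s i) = color i) ->
  rename s (deg_sum u [set: idx n]) = (-1) ^+ odd_perm s * deg_sum u [set: idx n].
Proof.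
move=> cs; pose f := rename_inj (F := F) (n := n) (p := n) (@perm_inj _ s).
have fc a : f (cst_rmorphism n a) = cst_rmorphism n a by exact: rename_cst.
apply: etrans (alg_sum_morph _ _ _ _ fc) _.
rewrite /deg_sum /deg_kern -alg_sum_perm //; congr (alg_sum _ _ _ _ _).
  apply/funext => x; apply/funext => y.
  rewrite /kern rmorphM rmorphB !rmorphM.
  by rewrite rmorphXn rmorphN1 rmorph1 /= !rename_z rename_cst.
apply/funext => l; apply/funext => x; rewrite /letter /=.
by case: eqP => _; rewrite ?rmorph0 // fmorphXz /= rename_z.
Qed.

Lemma rename_perm_vandermonde (n : degree) (s : 'S_(\sum_a n a)) :
  (forall i : idx n, color (s i) = color i) ->
  rename s (deg_vandermonde n) = (-1) ^+ odd_perm s * deg_vandermonde n.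
Proof.
move=> cs; pose f := rename_inj (F := F) (n := n) (p := n) (@perm_inj _ s).
rewrite /deg_vandermonde -(pair_prod_vandermonde _ (@color_homo r n) cs).
apply: etrans (rmorph_prod f _ _ _) _; apply: eq_bigr => i _.
apply: etrans (rmorph_prod f _ _ _) _; apply: eq_bigr => j _.
by rewrite rmorphB /= !rename_z.
Qed.

Lemma free_pi_Sh u (n : degree) : Sh_comp A d q (free_pi u n).
Proof.
have [P [k [e wz]]] := deg_sum_laurent u n; exists (laurent_frac P k); split.
- by exists P, k.
(* The numerator and the Vandermonde acquire the same sign, so their Laurent quotient is
   symmetric. *)
- move=> s cs; pose f := rename_inj (F := F) (n := n) (p := n) (@perm_inj _ s).
  have := rename_perm_deg_sum u cs; rewrite e.
  have -> : rename s (deg_vandermonde n * laurent_frac P k)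
      = rename s (deg_vandermonde n) * rename s (laurent_frac P k) by exact: (rmorphM f).
  rewrite rename_perm_vandermonde // -mulrA => /(mulfI _) h.
  by apply: (mulfI (deg_vandermonde_neq0 n)); apply: h; rewrite signr_eq0.
- move=> a b t j v ab cj ti ct v0 hw; exists P, k; split=> //.
  by rewrite (wz a b t j v) ?mul0r.
by rewrite /free_pi e /qden pair_prodT /prefactor -/(deg_vandermonde n) mulrAC.
Qed.

End ShuffleMorphism.

Theorem theorem0p3 (R : realType) (r : nat) (A : 'M[int]_r) (d : 'I_r -> nat)
    (q : R[i]) (hA : simple_cartan A d) (hq : q != 0) :
  exists pi : Uqn A d q -> ratfam R[i] r,
    [/\ is_alg_morphism A d q pi,
        forall x, in_Shbar A d q (pi x),
        forall (a : 'I_r) (k : int) n, pi (ugen A d q a k) n = zpow R[i] a k n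
      & ~ type_G2 A -> forall x, in_Sh A d q (pi x)].
Proof.
case: hA => _ Adiag Aoff _ _ d_gt0 Asym _.
have two_neq0 : 2 != 0 :> R[i] by rewrite pnatr_eq0.
pose fpi := free_pi A d q.
(* Independence of the representative: [u] and the representative of its class differ by an element
   of the ideal, on which [free_pi] vanishes. *)
have fpi_pi u n : fpi (repr (\pi_(Uqn A d q) u)) n = fpi u n.
  apply/eqP; rewrite -subr_eq0 -free_piB (free_pi_rel hq two_neq0 Adiag Aoff Asym) //.
  by apply/rel_idealP; rewrite Quotient.idealrBE reprK.
exists (fun x => fpi (repr x)).
have hSh (x : Uqn A d q) n : Sh_comp A d q (fpi (repr x) n) by exact: free_pi_Sh.
have hfin (x : Uqn A d q) : finsupp (fpi (repr x)) by exact: free_pi_finsupp.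
split=> [|x|a k n|_ x].
- split=> [c x y n|n|x y n].
  + have -> : c *: x + y = \pi_(Uqn A d q) (c *: repr x + repr y).
      by rewrite -{1}[x]reprK -{1}[y]reprK /GRing.scale /= !piE.
    by rewrite fpi_pi; exact: free_pi_lin.
  + have -> : 1 = \pi_(Uqn A d q) 1 by rewrite /GRing.one /= !piE.
    by rewrite fpi_pi; exact: free_pi1.
  + have -> : x * y = \pi_(Uqn A d q) (repr x * repr y).
      by rewrite -{1}[x]reprK -{1}[y]reprK /GRing.mul /= !piE.
    by rewrite fpi_pi; exact: free_piM.
- by split=> [|n]; [exact: hfin | have [B [lB sB _ e]] := hSh x n; exists B].
- by rewrite fpi_pi; exact: free_pi_gen.
- by split; [exact: hfin | move=> n; exact: hSh].
Qed.
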